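(* Let $\mathcal{B}$ be a $C^*$-algebra and let $E$ be a full Hilbert $\mathcal{B}$-module. Suppose that $d$ is a $*$-derivation of $\mathcal{B}$ that is the generator of a $C_0$-group $\varphi=(\varphi_t)_{t\in\mathbb{R}}$ on $\mathcal{B}$, and suppose that $\delta$ is a $d$-derivation of $E$ that is the generator of a $C_0$-group $u=(u_t)_{t\in\mathbb{R}}$ on $E$. Then $u$ is a dynamical system on $E$ and $\varphi$ is the $C^*$-dynamical system associated with $u$. Moreover, $\mathrm{span}\,\langle\mathrm{dom}(\delta),\mathrm{dom}(\delta)\rangle$ is a core for $d$, and $\delta$ is a ternary derivation and a $d$-derivation.
   Context: Hilbert modules are right modules with inner product linear in the second argument; $E$ is full if $\mathrm{span}\,\langle E,E\rangle$ is dense in $\mathcal{B}$. A $C_0$-group on a Banach space is a strongly continuous one-parameter group of (linear) Banach space isometries. A $*$-derivation of $\mathcal{B}$ is a linear map $d\colon\mathrm{dom}(d)\to\mathcal{B}$ on a dense $*$-subalgebra with $d(bb')=d(b)b'+bd(b')$ and $d(b^* )=d(b)^*$. A $d$-derivation of $E$ is a densely defined linear map $\delta\colon E\supset\mathrm{dom}(\delta)\to E$ such that $xb\in\mathrm{dom}(\delta)$ and $\delta(xb)=\delta(x)b+xd(b)$ for all $x\in\mathrm{dom}(\delta)$, $b\in\mathrm{dom}(d)$. A ternary derivation of $E$ is a densely defined linear map $\delta$ such that $x\langle y,z\rangle\in\mathrm{dom}(\delta)$ and $\delta(x\langle y,z\rangle)=\delta(x)\langle y,z\rangle+x\langle\delta(y),z\rangle+x\langle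 y,\delta(z)\rangle$ for all $x,y,z\in\mathrm{dom}(\delta)$. A dynamical system on $E$ is a strongly continuous one-parameter group $(u_t)$ of generalized unitaries, i.e. surjections $u_t$ on $E$ for which there are automorphisms $\varphi_t$ of $\mathcal{B}$ with $\langle u_tx,u_ty\rangle=\varphi_t(\langle x,y\rangle)$ for all $x,y\in E$; as $E$ is full, the $\varphi_t$ are unique and form a $C^*$-dynamical system (strongly continuous one-parameter group of $*$-automorphisms) on $\mathcal{B}$, called the $C^*$-dynamical system associated with $u$. A core for a closed operator $d$ is a subspace of $\mathrm{dom}(d)$ such that $d$ is the closure of its restriction to that subspace. *)

(* Defs.v *)
(* Scalars are the complex numbers R[i] over an arbitrary R : realType; the norm
   of a normedModType R[i] takes its values in R[i] (as nonnegative, hence real,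
   elements). *)
From HB Require Import structures.
From mathcomp Require Import all_boot all_order all_algebra.
From mathcomp Require Import boolp classical_sets reals topology normedtype.
From mathcomp Require Import complex.
Set Implicit Arguments.
Unset Strict Implicit.
Unset Printing Implicit Defensive.
Import Order.TTheory GRing.Theory Num.Theory.
Import numFieldNormedType.Exports.
Local Open Scope classical_set_scope.
Local Open Scope ring_scope.
Local Open Scope complex_scope.

Reserved Notation "a ** b" (at level 40, left associativity).
Reserved Notation "x *> b" (at level 40, left associativity).

(* No unit is assumed, so the product is a separate operation and not the
   multiplication of a MathComp ring. *)
HB.mixin Record isCStarAlgebra (R : realType) B
    & CompleteNormedModule R[i] B := {
  cmul : B -> B -> B;
  star : B -> B;
  cmulA : forall a b c : B, cmul a (cmul b c) = cmul (cmul a b) c;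
  cmulDl : forall a b c : B, cmul (a + b) c = cmul a c + cmul b c;
  cmulDr : forall a b c : B, cmul a (b + c) = cmul a b + cmul a c;
  cmulZl : forall (l : R[i]) (a b : B), cmul (l *: a) b = l *: cmul a b;
  cmulZr : forall (l : R[i]) (a b : B), cmul a (l *: b) = l *: cmul a b;
  starK : forall a : B, star (star a) = a;
  starD : forall a b : B, star (a + b) = star a + star b;
  starZ : forall (l : R[i]) (a : B), star (l *: a) = (Num.conj l) *: star a;
  starM : forall a b : B, star (cmul a b) = cmul (star b) (star a);
  normcM_le : forall a b : B, `|cmul a b| <= `|a| * `|b|;
  norm_starM : forall a : B, `|cmul (star a) a| = `|a| ^+ 2
}.

#[short(type="cStarAlgType")]
HB.structure Definition CStarAlgebra (R : realType) :=
  {B of CompleteNormedModule R[i] B & isCStarAlgebra R B}.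

Notation "a ** b" := (cmul a b) : ring_scope.

Definition cpositive (R : realType) (B : cStarAlgType R) (a : B) : Prop :=
  exists b : B, a = star b ** b.

(* The norm of E, for which E is complete, is |x| = |<x, x>| ^ (1/2). *)
HB.mixin Record isHilbertModule (R : realType) (B : cStarAlgType R) E
    & CompleteNormedModule R[i] E := {
  ract : E -> B -> E;
  inner : E -> E -> B;
  ractA : forall (x : E) (b c : B), ract x (b ** c) = ract (ract x b) c;
  ractDl : forall (x y : E) (b : B), ract (x + y) b = ract x b + ract y b;
  ractDr : forall (x : E) (b c : B), ract x (b + c) = ract x b + ract x c;
  ractZl : forall (l : R[i]) (x : E) (b : B), ract (l *: x) b = l *: ract x b;
  ractZr : forall (l : R[i]) (x : E) (b : B), ract x (l *: b) = l *: ract x b;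
  innerDr : forall x y z : E, inner x (y + z) = inner x y + inner x z;
  innerZr : forall (l : R[i]) (x y : E), inner x (l *: y) = l *: inner x y;
  inner_ract : forall (x y : E) (b : B), inner x (ract y b) = inner x y ** b;
  inner_star : forall x y : E, star (inner x y) = inner y x;
  inner_pos : forall x : E, cpositive (inner x x);
  inner_def : forall x : E, inner x x = 0 -> x = 0;
  norm_inner : forall x : E, `|x| ^+ 2 = `|inner x x|
}.

#[short(type="hilbertModType")]
HB.structure Definition HilbertModule (R : realType) (B : cStarAlgType R) :=
  {E of CompleteNormedModule R[i] E & isHilbertModule R B E}.

Notation "x *> b" := (ract x b) : ring_scope.

Definition lin_span (K : numFieldType) (V : lmodType K) (S : set V) : set V :=
  [set v | exists (n : nat) (l : 'I_n -> K) (s : 'I_n -> V),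
     (forall i, s i \in S) /\ v = \sum_(i < n) l i *: s i].

Definition inner_set (R : realType) (B : cStarAlgType R)
    (E : hilbertModType B) (X Y : set E) : set B :=
  [set b | exists x y, [/\ x \in X, y \in Y & b = inner x y]].

Definition full (R : realType) (B : cStarAlgType R) (E : hilbertModType B) :=
  dense (lin_span (inner_set [set: E] [set: E])).

(* A linear map defined on the subspace dom; the values of the total function
   lop outside dom are irrelevant and are never used. *)
Record linop (K : numFieldType) (V : lmodType K) := Linop {
  dom : set V;
  lop :> V -> V;
  dom_submod : submod_closed [in dom];
  lop_linear : forall a : K,
    {in dom &, forall x y, lop (a *: x + y) = a *: lop x + lop y}
}.

Definition graph_on (K : numFieldType) (V : lmodType K) (d : linop V)
    (D : set V) : set (V * V) :=
  [set p | p.1 \in D /\ p.2 = d p.1].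

Definition is_core (K : numFieldType) (V : normedModType K) (d : linop V)
    (D : set V) : Prop :=
  [/\ submod_closed [in D], D `<=` dom d
    & closure (graph_on d D) = graph_on d (dom d)].

Definition one_param_group (R : realType) (V : Type) (u : R -> V -> V) :=
  (forall x, u 0 x = x) /\ (forall s t x, u (s + t) x = u s (u t x)).

Definition strongly_continuous (R : realType) (V : normedModType R[i])
    (u : R -> V -> V) :=
  forall x : V, continuous (fun t : R => u t x).

Definition is_C0_group (R : realType) (V : completeNormedModType R[i])
    (u : R -> V -> V) : Prop :=
  [/\ one_param_group u, strongly_continuous u,
      forall t, linear (u t)
    & forall t x, `|u t x| = `|x| ].

Definition is_generator (R : realType) (V : completeNormedModType R[i])
    (d : linop V) (u : R -> V -> V) : Prop :=
  forall x y : V, x \in dom d /\ d x = y <->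
    (t%:C^-1 *: (u t x - x)) @[t --> (0 : R)^'] --> y.

Definition is_star_derivation (R : realType) (B : cStarAlgType R)
    (d : linop B) : Prop :=
  [/\ dense (dom d),
      {in dom d &, forall b c, b ** c \in dom d},
      {in dom d, forall b, star b \in dom d},
      {in dom d &, forall b c, d (b ** c) = d b ** c + b ** d c}
    & {in dom d, forall b, d (star b) = star (d b)}].

Definition is_derivation_over (R : realType) (B : cStarAlgType R)
    (E : hilbertModType B) (d : linop B) (delta : linop E) : Prop :=
  dense (dom delta) /\
  forall x b, x \in dom delta -> b \in dom d ->
    x *> b \in dom delta /\ delta (x *> b) = delta x *> b + x *> d b.

Definition is_ternary_derivation (R : realType) (B : cStarAlgType R)
    (E : hilbertModType B) (delta : linop E) : Prop :=
  dense (dom delta) /\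
  forall x y z, x \in dom delta -> y \in dom delta -> z \in dom delta ->
    x *> inner y z \in dom delta /\
    delta (x *> inner y z) =
      delta x *> inner y z + x *> inner (delta y) z + x *> inner y (delta z).

Definition is_star_automorphism (R : realType) (B : cStarAlgType R)
    (f : B -> B) : Prop :=
  [/\ linear f, bijective f,
      forall a b, f (a ** b) = f a ** f b
    & forall a, f (star a) = star (f a)].

(* Linearity is not required: it is a consequence. *)
Definition is_generalized_unitary (R : realType) (B : cStarAlgType R)
    (E : hilbertModType B) (v : E -> E) : Prop :=
  (forall y, exists x, v x = y) /\
  exists f : B -> B, is_star_automorphism f /\
    forall x y, inner (v x) (v y) = f (inner x y).

Definition is_dynamical_system (R : realType) (B : cStarAlgType R)
    (E : hilbertModType B) (u : R -> E -> E) : Prop :=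
  [/\ one_param_group u, strongly_continuous u
    & forall t, is_generalized_unitary (u t)].

Definition is_cstar_dynamical_system (R : realType) (B : cStarAlgType R)
    (phi : R -> B -> B) : Prop :=
  [/\ one_param_group phi, strongly_continuous phi
    & forall t, is_star_automorphism (phi t)].

(* Over a full E, at most one phi is associated with u. *)
Definition is_associated_system (R : realType) (B : cStarAlgType R)
    (E : hilbertModType B) (u : R -> E -> E) (phi : R -> B -> B) : Prop :=
  is_cstar_dynamical_system phi /\
  forall t x y, inner (u t x) (u t y) = phi t (inner x y).

(* Main.v *)
(* Differentiating [phi_-t (phi_t b ** phi_t c)], [phi_-t (star (phi_t b))] and
   [u_-t (u_t x *> phi_t b)] shows that these curves are constant on the domains,
   so every [phi_t] is a star-automorphism and [u_t (x *> b) = u_t x *> phi_t b].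
   As [u_t] is isometric, [phi_-t <u_t x, u_t x>] and [<x, x>] are elements
   [m^* m] and [k^* k] with [|m b| = |k b|] for all [b], and this forces
   [m^* m = k^* k] (Paschke): up to [e > 0], the choice [b = (k^* k + e)^(-1/2)]
   gives [|k b| <= 1], hence [|m b| <= 1], hence [m^* m <= k^* k + e].  By
   polarization [<u_t x, u_t y> = phi_t <x, y>].  Differentiating this identity
   gives the Leibniz rule for [<x, y>], so the span of [<dom delta, dom delta>] is
   a dense [phi]-invariant subspace of [dom d], and such a subspace is a core.

   The order and the square roots used here live in the unitization of [B]. *)
From HB Require Import structures.
Require Import Defs.
From mathcomp Require Import all_boot all_order all_algebra.
From mathcomp Require Import boolp classical_sets reals topology normedtype sequences.
From mathcomp Require Import derive realfun.
From mathcomp Require Import complex ring lra.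
Set Implicit Arguments.
Unset Strict Implicit.
Unset Printing Implicit Defensive.
Import Order.TTheory GRing.Theory Num.Theory.
Import numFieldNormedType.Exports.
Local Open Scope classical_set_scope.
Local Open Scope ring_scope.
Local Open Scope complex_scope.

(** * Real-valued norms *)

(** The obstacle is the order: the axioms provide norms only, so positivity is expressed by norm
    bounds. [pos h] asks, for every [e > 0], for some [s] with [|s - h| <= s + e]. Sums are then
    immediate, and the real work is the positivity of [k^* k]. No spectrum enters: squares of
    self-adjoint elements are positive by the C*-identity, square roots are fixed points of a
    contraction, and the passage from [d d^*] to [d^* d] compares growth rates of powers. The
    unitization is needed because [(k^* k + e)^(-1/2)] need not lie in [B]. It is given no norm,
    only the relation [bnd]. On the side of the groups, finite subdivisions of the time interval
    take the place of vector-valued integrals. Product, module action and inner product are all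
    treated as bounded bilinear maps over the reals. *)

Section RealNorm.
Variables (R : realType) (V : normedModType R[i]).
Implicit Types x y : V.

Definition rnorm x : R := complex.Re `|x|.

Lemma rnormE x : `|x| = (rnorm x)%:C.
Proof. by rewrite [(_)%:C]RRe_real //; exact: normr_real. Qed.

Lemma rnorm_ge0 x : 0 <= rnorm x.
Proof. by rewrite -ler0c -rnormE normr_ge0. Qed.

Lemma rnorm0 : rnorm 0 = 0. Proof. by rewrite /rnorm normr0. Qed.

Lemma rnorm_eq0 x : rnorm x = 0 -> x = 0.
Proof. by move=> h; apply: normr0_eq0; rewrite rnormE h. Qed.

Lemma rnormD x y : rnorm (x + y) <= rnorm x + rnorm y.
Proof. by rewrite -lecR rmorphD /= -!rnormE ler_normD. Qed.

Lemma rnormN x : rnorm (- x) = rnorm x.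
Proof. by rewrite /rnorm normrN. Qed.

Lemma rdistC x y : rnorm (x - y) = rnorm (y - x).
Proof. by rewrite /rnorm distrC. Qed.

Lemma rdistD z x y : rnorm (x - y) <= rnorm (x - z) + rnorm (z - y).
Proof. by rewrite -[x - y](subrKA z) rnormD. Qed.

End RealNorm.

Lemma rnorm_real (R : realType) (l : R) : rnorm (l%:C : R[i]^o) = `|l|.
Proof. by rewrite /rnorm normc_def /= expr0n /= addr0 sqrtr_sqr. Qed.

Lemma rnormM (R : realType) (l m : R[i]^o) : rnorm (l * m : R[i]^o) = rnorm l * rnorm m.
Proof. by apply: complexI; rewrite rmorphM /= -!rnormE normrM. Qed.

Lemma rnorm_conj (R : realType) (l : R[i]^o) : rnorm (Num.conj l : R[i]^o) = rnorm l.
Proof. by rewrite /rnorm norm_conjC. Qed.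

Lemma rnormZ (R : realType) (V : normedModType R[i]) (l : R[i]) (x : V) :
  rnorm (l *: x) = rnorm (l : R[i]^o) * rnorm x.
Proof.
by apply: complexI; rewrite rmorphM /= -!rnormE normrZ.
Qed.

Lemma rnormZR (R : realType) (V : normedModType R[i]) (l : R) (x : V) :
  rnorm (l%:C *: x) = `|l| * rnorm x.
Proof. by rewrite rnormZ rnorm_real. Qed.

Lemma ball_rnorm (R : realType) (V : normedModType R[i]) (x y : V) (e : R) :
  ball x e%:C y <-> rnorm (x - y) < e.
Proof. by rewrite -ball_normE /ball_ /= rnormE ltcR. Qed.

Lemma ball_rnorm' (R : realType) (V : normedModType R[i]) (x y : V) (e : R[i]) :
  0 < e -> ball x e y <-> rnorm (x - y) < complex.Re e.
Proof.
by move=> e0; rewrite -ball_rnorm RRe_real// ger0_real// ltW.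
Qed.

Lemma Re_gt0 (R : realType) (e : R[i]) : 0 < e -> 0 < complex.Re e.
Proof. by rewrite ltcE => /andP[]. Qed.

Lemma geometric_small (R : realType) (M r e : R) : 0 <= M -> 0 <= r -> r < 1 ->
  0 < e -> exists n, M * r ^+ n < e.
Proof.
move=> M0 r0 r1 e0.
have : (fun n => M * r ^+ n) @ \oo --> (M * 0 : R).
  by apply: cvgMr; apply: cvg_expr; rewrite ger0_norm.
rewrite mulr0 => /cvgrPdist_lt/(_ e e0)[n _ hn]; exists n.
have := hn n (leqnn n); rewrite /= sub0r normrN ger0_norm//.
by rewrite mulr_ge0 ?exprn_ge0.
Qed.

Lemma geometric_limit (R : realType) (V : completeNormedModType R[i])
    (x : nat -> V) (M r : R) : 0 <= M -> 0 <= r -> r < 1 ->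
  (forall n, rnorm (x n.+1 - x n) <= M * r ^+ n) ->
  exists l, forall n, rnorm (l - x n) <= M * r ^+ n / (1 - r).
Proof.
move=> M0 r0 r1 hx.
have r1' : 0 < 1 - r by rewrite subr_gt0.
have hk n k : rnorm (x (n + k)%N - x n) <= M * r ^+ n / (1 - r).
  (* The factor [1 - r ^+ k] is that of the exact partial geometric sum, which passes the induction;
     it is dropped afterwards. *)
  have : rnorm (x (n + k)%N - x n) <= M * r ^+ n / (1 - r) * (1 - r ^+ k).
    elim: k => [|k IH]; first by rewrite addn0 subrr rnorm0 expr0 subrr mulr0.
    apply: (le_trans (rdistD (x (n + k)%N) _ _)).
    rewrite addnS; apply: (le_trans (lerD (hx _) IH)).
    rewrite le_eqVlt; apply/orP; left; apply/eqP.
    rewrite exprD exprS; field; lra.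
  move/le_trans; apply; rewrite ler_piMr ?divr_ge0 ?mulr_ge0 ?exprn_ge0//.
    exact: ltW.
  by rewrite gerBl exprn_ge0.
have hlim (e : R) : 0 < e -> exists N, M * r ^+ N / (1 - r) < e.
  move=> e0; have [|N] := @geometric_small _ (M / (1 - r)) r e _ r0 r1 e0.
    by rewrite divr_ge0// ltW.
  by rewrite mulrAC; exists N.
have : cauchy (x @ \oo).
  apply: cauchy_exP => e e0.
  have [N hN] := hlim _ (Re_gt0 e0).
  exists (x N); exists N => // n /= Nn; apply/ball_rnorm' => //.
  by rewrite rdistC -(subnKC Nn); apply: le_lt_trans (hk _ _) hN.
move=> /cauchy_cvgP/cvg_ex[l hl]; exists l => n.
apply/ler_addgt0Pr => e e0.
move: hl => /cvgrPdist_lt/(_ e%:C); rewrite ltcR => /(_ e0)[N _ hN].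
have := hN (N + n)%N (leq_addr _ _); rewrite /= rnormE ltcR => h.
apply: (le_trans (rdistD (x (n + N)%N) _ _)); rewrite addrC lerD ?hk//.
by rewrite addnC ltW.
Qed.

(** * The unitization of a C*-algebra *)

Section Unitization.
Variables (R : realType) (B : cStarAlgType R).

Lemma starB (a b : B) : star (a - b) = star a - star b.
Proof. by rewrite -scaleN1r starD starZ rmorphN1 scaleN1r. Qed.

Lemma star0 : star (0 : B) = 0.
Proof. by have := starB 0 0; rewrite !subrr. Qed.

Lemma starN (a : B) : star (- a) = - star a.
Proof. by rewrite -[- a]sub0r starB star0 sub0r. Qed.

Lemma cmul0r (a : B) : a ** 0 = 0.
Proof. by have := cmulZr 0 a 0; rewrite !scale0r. Qed.

Lemma cmul0l (a : B) : 0 ** a = 0.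
Proof. by have := cmulZl 0 0 a; rewrite !scale0r. Qed.

Lemma rnorm_cmul (a b : B) : rnorm (a ** b) <= rnorm a * rnorm b.
Proof. by rewrite -lecR rmorphM /= -!rnormE normcM_le. Qed.

Lemma rnorm_cstar (a : B) : rnorm (star a ** a) = rnorm a ^+ 2.
Proof. by apply: complexI; rewrite rmorphXn /= -!rnormE norm_starM. Qed.

Lemma rnorm_star_le (a : B) : rnorm a <= rnorm (star a).
Proof.
have := rnorm_cmul (star a) a; rewrite rnorm_cstar expr2.
have [->|n0] := eqVneq (rnorm a) 0; first by rewrite rnorm_ge0.
by rewrite ler_pM2r// lt_neqAle eq_sym n0 rnorm_ge0.
Qed.

Lemma rnorm_star (a : B) : rnorm (star a) = rnorm a.
Proof.
by apply/eqP; rewrite eq_le rnorm_star_le -{2}[a]starK rnorm_star_le.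
Qed.

(** The norm of the product space violates the C*-identity in general, so only the linear structure
    is taken over; sizes are measured by [bnd]. *)
Definition unitz := (R[i]^o * B)%type.

HB.instance Definition _ := GRing.Lmodule.copy unitz (R[i]^o * B)%type.

Definition uone : unitz := (1, 0).
Definition umul (a b : unitz) : unitz :=
  (a.1 * b.1, a.1 *: b.2 + b.1 *: a.2 + a.2 ** b.2).

Lemma umulA : associative umul.
Proof.
move=> [a x] [b y] [c z]; congr pair => /=; first by rewrite mulrA.
rewrite !(cmulDl, cmulDr, cmulZl, cmulZr, scalerDr, scalerA, cmulA) -!addrA.
rewrite [c * b]mulrC [c * a]mulrC; congr (_ + _); congr (_ + _).
by rewrite addrCA; congr (_ + _); rewrite [RHS]addrCA; congr (_ + _); rewrite addrCA.
Qed.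

Lemma umul1r : left_id uone umul.
Proof.
by move=> [a x]; rewrite /umul /= mul1r scale1r cmul0l scaler0 !addr0.
Qed.

Lemma umulr1 : right_id uone umul.
Proof.
by move=> [a x]; rewrite /umul /= mulr1 scale1r cmul0r scaler0 add0r addr0.
Qed.

Lemma umulDl : left_distributive umul +%R.
Proof.
move=> [a x] [b y] [c z]; congr pair => /=; first by rewrite mulrDl.
rewrite scalerDl cmulDl scalerDr [X in X + _ = _]addrACA; exact: addrACA.
Qed.

Lemma umulDr : right_distributive umul +%R.
Proof.
move=> [a x] [b y] [c z]; congr pair => /=; first by rewrite mulrDr.
rewrite scalerDl cmulDr scalerDr [X in X + _ = _]addrACA; exact: addrACA.
Qed.

Lemma uone_neq0 : uone != 0.
Proof. by apply/eqP => -[/eqP]; rewrite oner_eq0. Qed.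

HB.instance Definition _ :=
  GRing.Zmodule_isNzRing.Build unitz umulA umul1r umulr1 umulDl umulDr uone_neq0.

Lemma uscaleAl (l : R[i]) (a b : unitz) : l *: (a * b) = l *: a * b.
Proof.
case: a b => [a x] [b y]; congr pair => /=; first exact: mulrA.
by rewrite !scalerDr !scalerA cmulZl [b * l]mulrC.
Qed.

HB.instance Definition _ := GRing.Lmodule_isLalgebra.Build R[i] unitz uscaleAl.

Lemma uscaleAr (l : R[i]) (a b : unitz) : l *: (a * b) = a * (l *: b).
Proof.
case: a b => [a x] [b y]; congr pair => /=; first by rewrite mulrCA.
by rewrite !scalerDr !scalerA cmulZr [a * l]mulrC.
Qed.

HB.instance Definition _ := GRing.Lalgebra_isAlgebra.Build R[i] unitz uscaleAr.

Definition uadj (a : unitz) : unitz := (Num.conj a.1, star a.2).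

Lemma uadjK : involutive uadj.
Proof. by move=> [a x]; rewrite /uadj /= conjCK starK. Qed.

Lemma uadjD (a b : unitz) : uadj (a + b) = uadj a + uadj b.
Proof. by rewrite /uadj /= rmorphD starD. Qed.

Lemma uadjZ (l : R[i]) (a : unitz) : uadj (l *: a) = Num.conj l *: uadj a.
Proof. by rewrite /uadj /= rmorphM starZ. Qed.

Lemma uadjM (a b : unitz) : uadj (a * b) = uadj b * uadj a.
Proof.
case: a b => [a x] [b y]; congr pair => /=; first by rewrite rmorphM mulrC.
by rewrite !starD !starZ starM; congr (_ + _); rewrite addrC.
Qed.

Lemma uadj1 : uadj 1 = 1.
Proof. by rewrite /uadj /= rmorph1 star0. Qed.

Lemma uadjN (a : unitz) : uadj (- a) = - uadj a.
Proof. by rewrite /uadj /= rmorphN starN. Qed.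

Lemma uadjB (a b : unitz) : uadj (a - b) = uadj a - uadj b.
Proof. by rewrite uadjD uadjN. Qed.

Lemma uadjX (a : unitz) n : uadj (a ^+ n) = uadj a ^+ n.
Proof. by elim: n => [|n IH]; rewrite ?uadj1// exprS exprSr uadjM IH. Qed.

Lemma uadjZR (l : R) (a : unitz) : uadj (l%:C *: a) = l%:C *: uadj a.
Proof. by rewrite uadjZ; congr (_ *: _); apply: CrealP; rewrite complex_real. Qed.

Definition uact (a : unitz) (y : B) : B := a.1 *: y + a.2 ** y.

Lemma uactD a b y : uact (a + b) y = uact a y + uact b y.
Proof. by rewrite /uact /= scalerDl cmulDl addrACA. Qed.

Lemma uactZ (l : R[i]) a y : uact (l *: a) y = l *: uact a y.
Proof. by rewrite /uact /= scalerDr scalerA cmulZl. Qed.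

Lemma uactM a b y : uact (a * b) y = uact a (uact b y).
Proof.
rewrite /uact /= !(cmulDl, cmulDr, cmulZl, cmulZr, scalerDr, scalerA, cmulA).
by rewrite -!addrA; congr (_ + _); congr (_ + _).
Qed.

Lemma uact1 y : uact 1 y = y.
Proof. by rewrite /uact /= scale1r cmul0l addr0. Qed.

(** [B] is a Hilbert module over itself with inner product [star y ** z], and [uadj a] acts as the
    adjoint of [a]. Both [bnd_adj] and [bnd_cstar] rest on this. *)
Lemma uact_adj a y z : star (uact a y) ** z = star y ** uact (uadj a) z.
Proof.
by rewrite /uact starD starZ starM cmulDl cmulDr cmulZl cmulZr cmulA.
Qed.

(* [a] acts on [B] by [uact a]; a bound on its scalar part is required as well,
   because for unital [B] this action is not faithful. *)
Definition bnd (a : unitz) (M : R) :=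
  rnorm a.1 <= M /\ forall y, rnorm (uact a y) <= M * rnorm y.

Lemma bnd_ge0 a M : bnd a M -> 0 <= M.
Proof. by case=> h _; apply: le_trans h; apply: rnorm_ge0. Qed.

Lemma bnd_le a M N : bnd a M -> M <= N -> bnd a N.
Proof.
move=> [h1 h2] MN; split=> [|y]; first exact: le_trans MN.
by apply: le_trans (h2 _) _; rewrite ler_wpM2r ?rnorm_ge0.
Qed.

Lemma bnd0 : bnd 0 0.
Proof. by split=> [|y]; rewrite ?rnorm0// /uact scale0r cmul0l addr0 rnorm0 mul0r. Qed.

Lemma bnd1 : bnd 1 1.
Proof. by split=> [|y]; rewrite ?uact1 ?mul1r// (rnorm_real 1) normr1. Qed.

Lemma bndD a b M N : bnd a M -> bnd b N -> bnd (a + b) (M + N).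
Proof.
move=> [a1 a2] [b1 b2]; split=> [|y]; first exact: le_trans (rnormD _ _) (lerD _ _).
by rewrite uactD mulrDl; exact: le_trans (rnormD _ _) (lerD _ _).
Qed.

Lemma bndZ (l : R[i]) a M : bnd a M -> bnd (l *: a) (rnorm (l : R[i]^o) * M).
Proof.
move=> [a1 a2]; split=> [|y]; first by rewrite rnormZ ler_wpM2l ?rnorm_ge0.
by rewrite uactZ rnormZ -mulrA ler_wpM2l ?rnorm_ge0.
Qed.

Lemma bndZR (l : R) a M : bnd a M -> bnd (l%:C *: a) (`|l| * M).
Proof. by move=> /(bndZ l%:C); rewrite rnorm_real. Qed.

Lemma bndN a M : bnd a M -> bnd (- a) M.
Proof. by move=> /(bndZR (-1)); rewrite normrN1 mul1r rmorphN1 scaleN1r. Qed.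

Lemma bndM a b M N : bnd a M -> bnd b N -> bnd (a * b) (M * N).
Proof.
move=> ha hb; have [M0 N0] := (bnd_ge0 ha, bnd_ge0 hb).
case: ha hb => [a1 a2] [b1 b2]; split=> [|y].
  by rewrite rnormM ler_pM ?rnorm_ge0.
rewrite uactM -mulrA; apply: le_trans (a2 _) _.
by rewrite ler_wpM2l.
Qed.

Lemma bndX a M n : bnd a M -> bnd (a ^+ n) (M ^+ n).
Proof.
move=> ha; elim: n => [|n IH]; first exact: bnd1.
by rewrite !exprS; apply: bndM.
Qed.

Lemma bndR (s : R) : bnd (s%:C *: 1) `|s|.
Proof. by rewrite -[`|s|]mulr1; exact: bndZR bnd1. Qed.

Lemma bnd_lim a M : (forall e, 0 < e -> bnd a (M + e)) -> bnd a M.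
Proof.
move=> h; split=> [|y].
  by apply/ler_addgt0Pr => e /h[].
have [y0|/negP y0] := boolP (rnorm y == 0).
  have [_ /(_ y)] := h 1 ltr01; rewrite (rnorm_eq0 (eqP y0)).
  by rewrite rnorm0 !mulr0.
have y1 : 0 < rnorm y by rewrite lt_neqAle rnorm_ge0 eq_sym andbT; apply/negP.
apply/ler_addgt0Pr => e e0.
have [_ /(_ y)] := h (e / rnorm y) (divr_gt0 e0 y1).
by rewrite mulrDl divfK ?gt_eqF.
Qed.

(** The scalar part vanishes by the first half of [bnd]; the remaining [x] sends [star x] to zero,
    and the C*-identity gives [x = 0]. *)
Lemma bnd_eq0 a : bnd a 0 -> a = 0.
Proof.
case: a => [l x] [/= h1 h2].
have /rnorm_eq0 l0 : rnorm l = 0 by apply/eqP; rewrite eq_le h1 rnorm_ge0.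
subst l; congr pair.
have := h2 (star x); rewrite mul0r /uact /= scale0r add0r -{1}[x]starK.
rewrite rnorm_cstar rnorm_star => h; apply/rnorm_eq0/eqP.
by rewrite -sqrf_eq0 eq_le h sqr_ge0.
Qed.

Lemma bnd_exists a : exists M, bnd a M.
Proof.
exists (rnorm a.1 + rnorm a.2); split=> [|y]; first by rewrite lerDl rnorm_ge0.
by rewrite mulrDl; apply: le_trans (rnormD _ _) (lerD _ (rnorm_cmul _ _)); rewrite rnormZ.
Qed.

(** [|a^* y|^2 = |y^* a a^* y| <= |y| M |a^* y|], and one factor cancels. *)
Lemma bnd_adj a M : bnd a M -> bnd (uadj a) M.
Proof.
move=> ha; have M0 := bnd_ge0 ha; case: ha => h1 h2; split=> [|y].
  by rewrite rnorm_conj.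
have [->|n0] := eqVneq (rnorm (uact (uadj a) y)) 0; first by rewrite mulr_ge0 ?rnorm_ge0.
rewrite -(@ler_pM2r _ (rnorm (uact (uadj a) y))); last first.
  by rewrite lt_neqAle eq_sym n0 rnorm_ge0.
rewrite -expr2 -rnorm_cstar uact_adj uadjK.
apply: le_trans (rnorm_cmul _ _) _; rewrite rnorm_star mulrAC [leRHS]mulrC.
by rewrite ler_wpM2l ?rnorm_ge0.
Qed.

(** [|a y|^2 = |y^* a^* a y| <= M^2 |y|^2], and likewise for the scalar part. *)
Lemma bnd_cstar a M : 0 <= M -> bnd (uadj a * a) (M ^+ 2) -> bnd a M.
Proof.
move=> M0 [h1 h2]; split=> [|y]; rewrite -ler_sqr ?nnegrE ?mulr_ge0 ?rnorm_ge0//.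
  by apply: le_trans h1; rewrite rnormM rnorm_conj expr2.
rewrite -rnorm_cstar uact_adj -uactM.
apply: le_trans (rnorm_cmul _ _) _; rewrite rnorm_star mulrC exprMn expr2 mulrA.
by rewrite ler_wpM2r ?rnorm_ge0// -expr2.
Qed.

Definition uinj (b : B) : unitz := (0, b).

Lemma uinjM a b : uinj (a ** b) = uinj a * uinj b.
Proof. by congr pair => /=; rewrite ?mul0r// !scale0r !add0r. Qed.

Lemma uadj_uinj a : uadj (uinj a) = uinj (star a).
Proof. by rewrite /uadj /= rmorph0. Qed.

Lemma uinjB a b : uinj (a - b) = uinj a - uinj b.
Proof. by congr pair => /=; rewrite subr0. Qed.

Lemma uact_uinj b y : uact (uinj b) y = b ** y.
Proof. by rewrite /uact scale0r add0r. Qed.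

Lemma bnd_complete (x : nat -> unitz) (M r : R) : 0 <= M -> 0 <= r -> r < 1 ->
  (forall n, (x n.+1).1 = (x n).1) ->
  (forall n, bnd (x n.+1 - x n) (M * r ^+ n)) ->
  exists l, forall n, bnd (l - x n) (M * r ^+ n / (1 - r)).
Proof.
move=> M0 r0 r1 hs hb.
have hs0 n : (x n).1 = (x 0%N).1 by elim: n => // n <-.
have [n|l hl] := @geometric_limit _ B (fun n => (x n).2) M r M0 r0 r1.
  (* Testing on the adjoint of the difference turns the [bnd] estimate into a norm estimate in
     [B]. *)
  have [_ /(_ (star ((x n.+1).2 - (x n).2)))] := hb n.
  rewrite /uact /= !hs0 subrr scale0r add0r.
  rewrite -{1}[_ - _]starK rnorm_cstar rnorm_star expr2.
  have [->|n0] := eqVneq (rnorm ((x n.+1).2 - (x n).2)) 0.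
    by rewrite mulr_ge0// exprn_ge0.
  by rewrite ler_pM2r// lt_neqAle eq_sym n0 rnorm_ge0.
exists ((x 0%N).1, l) => n; have h0 := le_trans (rnorm_ge0 _) (hl n).
split=> [|y]; first by rewrite /= !hs0 subrr rnorm0.
rewrite /uact /= !hs0 subrr scale0r add0r.
by apply: le_trans (rnorm_cmul _ _) _; rewrite ler_wpM2r ?rnorm_ge0.
Qed.

End Unitization.
Arguments uinj {R B}.

(** * Positive elements *)

(** Bookkeeping of polarization: [p], [q], [r], [s] are the four terms of a biadditive form
    evaluated at [a + b] in both places. It serves products and inner products alike. *)
Lemma addr_polar (V : zmodType) (p q r s : V) :
  (p + q + (r + s)) - (p - q - (r - s)) = q + r + (q + r).
Proof.
have -> : p + q + (r + s) = p + s + (q + r) by rewrite [r + s]addrC addrACA.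
have -> : p - q - (r - s) = p + s - (q + r) by rewrite opprB addrACA -opprD.
by rewrite opprB addrC addrA subrK.
Qed.

Section Positivity.
Variables (R : realType) (B : cStarAlgType R).
Local Notation U := (unitz B).
Implicit Types a b c h k w x : U.

Definition ur (s : R) : U := s%:C *: 1.

Lemma ur0 : ur 0 = 0. Proof. by rewrite /ur rmorph0 scale0r. Qed.
Lemma ur1 : ur 1 = 1. Proof. by rewrite /ur rmorph1 scale1r. Qed.
Lemma urD s t : ur (s + t) = ur s + ur t.
Proof. by rewrite /ur rmorphD scalerDl. Qed.
Lemma urN s : ur (- s) = - ur s.
Proof. by rewrite /ur rmorphN scaleNr. Qed.
Lemma urB s t : ur (s - t) = ur s - ur t.
Proof. by rewrite urD urN. Qed.
Lemma urZ s t : ur (s * t) = s%:C *: ur t.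
Proof. by rewrite /ur rmorphM scalerA. Qed.
Lemma uadj_ur s : uadj (ur s) = ur s.
Proof. by rewrite uadjZR uadj1. Qed.
Lemma urMl s a : ur s * a = s%:C *: a.
Proof. by rewrite -scalerAl mul1r. Qed.
Lemma urMr s a : a * ur s = s%:C *: a.
Proof. by rewrite -scalerAr mulr1. Qed.
Lemma scaleRD (s t : R) a : (s + t)%:C *: a = s%:C *: a + t%:C *: a.
Proof. by rewrite rmorphD scalerDl. Qed.
Lemma scaleRA (s t : R) a : s%:C *: (t%:C *: a) = (s * t)%:C *: a.
Proof. by rewrite rmorphM scalerA. Qed.
Lemma scaleR1 a : (1 : R)%:C *: a = a.
Proof. by rewrite rmorph1 scale1r. Qed.
Lemma half_scale a : (2^-1 : R)%:C *: (a + a) = a.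
Proof. by rewrite scalerDr -scaleRD (_ : _ + _ = 1 :> R) ?scaleR1//; lra. Qed.

(* The C*-identity for [a + 'i b]. *)
Lemma sum_sq_bnd a b (M : R) : uadj a = a -> uadj b = b -> a * b = b * a ->
  0 <= M -> bnd (a * a + b * b) (M ^+ 2) -> bnd a M.
Proof.
move=> ha hb hab M0 hM; pose t := a + 'i%C *: b.
have ht : uadj t = a - 'i%C *: b.
  by rewrite /t uadjD uadjZ ha hb complexiE conjCi scaleNr.
have htt : uadj t * t = a * a + b * b.
  rewrite ht /t mulrDr !mulrBl -!scalerAr -!scalerAl scalerA hab.
  by rewrite -['i%C * 'i%C]expr2 sqr_i scaleN1r opprK addrA subrK.
have bt : bnd t M by apply: bnd_cstar => //; rewrite htt.
have e : a = (2^-1 : R)%:C *: (t + uadj t).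
  by rewrite ht /t addrACA subrr addr0 half_scale.
have := bndZR 2^-1 (bndD bt (bnd_adj bt)); rewrite -e => h.
apply: (bnd_le h); rewrite ger0_norm; lra.
Qed.

(** The C*-identity, iterated. It turns a growth rate of powers into a bound for [a] itself, in
    place of the spectral radius formula. *)
Lemma bnd_pow2 a (M : R) m : uadj a = a -> 0 <= M ->
  bnd (a ^+ (2 ^ m)) (M ^+ (2 ^ m)) -> bnd a M.
Proof.
move=> ha M0; elim: m => [|m IH]; first by rewrite expn0 !expr1.
rewrite expnSr !exprM => h; apply: IH; apply: bnd_cstar; rewrite ?exprn_ge0//.
by rewrite uadjX ha -expr2.
Qed.

(** Some bound [M] exists; improving it repeatedly gives [M r^n] for all [n], which tends to
    zero. *)
Lemma bnd_contract a (r : R) : 0 <= r -> r < 1 ->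
  (forall M, bnd a M -> bnd a (r * M)) -> a = 0.
Proof.
move=> r0 r1 h; have [M hM] := bnd_exists a; have M0 := bnd_ge0 hM.
apply: bnd_eq0; apply: bnd_lim => e e0; rewrite add0r.
have [n hn] := geometric_small M0 r0 r1 e0.
apply: (bnd_le (M := M * r ^+ n)); last exact: ltW.
elim: n {hn} => [|n IH]; first by rewrite expr0 mulr1.
by rewrite exprS mulrCA; apply: h.
Qed.

(** The map [a := (p a + a q) / 2] shrinks bounds by the factor [r], so zero is its only fixed
    point. Self-adjointness and commutation of the square root follow from this uniqueness. *)
Lemma sylvester0 p q a (r : R) : r < 1 -> bnd p r -> bnd q r ->
  a + a = p * a + a * q -> a = 0.
Proof.
move=> r1 hp hq ha; have r0 := bnd_ge0 hp.
apply: (@bnd_contract _ r) => // M hM; rewrite -(half_scale a) ha.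
have := bndZR 2^-1 (bndD (bndM hp hM) (bndM hM hq)) => h.
apply: (bnd_le h); rewrite ger0_norm ?invr_ge0// [M * r]mulrC; lra.
Qed.

(** Neumann series, as the iteration [c := 1 + v c]. The start [(1 - v.1)^-1] solves the scalar
    equation, so all iterates share their scalar part. As [v] is self-adjoint, the adjoint of a
    right inverse is a left inverse. *)
Lemma unit_inv v (r : R) : r < 1 -> bnd v r -> uadj v = v -> 
  exists b, [/\ uadj b = b, (1 - v) * b = 1 & b * (1 - v) = 1].
Proof.
move=> r1 hv sv; have r0 := bnd_ge0 hv.
have l1 : 1 - v.1 != 0.
  rewrite subr_eq0; apply: contraTneq r1 => hl; rewrite -leNgt.
  by case: hv => + _; rewrite -hl (rnorm_real 1) normr1.
pose g n := iter n (fun c => 1 + v * c) ((1 - v.1)^-1 *: 1 : U).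
have gS n : g n.+1 = 1 + v * g n by [].
have g1 n : (g n).1 = (1 - v.1)^-1.
  elim: n => [|n IH]; first exact: mulr1.
  by rewrite gS /= IH; apply: (mulfI l1); rewrite mulrDr mulr1 mulrCA divff// mulr1 subrK.
have [M hM] := bnd_exists (g 1%N - g 0%N); have M0 := bnd_ge0 hM.
have hg n : bnd (g n.+1 - g n) (M * r ^+ n).
  elim: n => [|n IH]; first by rewrite expr0 mulr1.
  rewrite !gS opprD addrACA subrr add0r -mulrBr exprS mulrCA.
  exact: bndM.
have [|b hb] := bnd_complete M0 r0 r1 _ hg; first by move=> n; rewrite !g1.
have hb1 : (1 - v) * b = 1.
  rewrite mulrBl mul1r; apply/eqP; rewrite subr_eq -subr_eq0; apply/eqP.
  apply: bnd_eq0; apply: bnd_lim => e e0; rewrite add0r.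
  (* The residual of [b] is bounded by two tails, at [n + 1] and at [n]; hence the factor 2. *)
  have [|n hn] := @geometric_small _ (2 * (M / (1 - r))) r e _ r0 r1 e0.
    by rewrite mulr_ge0// divr_ge0// subr_ge0 ltW.
  have -> : b - (1 + v * b) = (b - g n.+1) + v * - (b - g n).
    by rewrite gS opprB mulrBr !opprD !addrA subrK.
  apply: (bnd_le (bndD (hb n.+1) (bndM hv (bndN (hb n))))).
  apply: le_trans (ltW hn).
  rewrite exprS mulrDl mul1r.
  have -> : M * (r * r ^+ n) / (1 - r) + r * (M * r ^+ n / (1 - r)) =
    r * (M / (1 - r) * r ^+ n + M / (1 - r) * r ^+ n) by ring.
  rewrite mulrDl; apply: ler_piMl (ltW r1).
  by rewrite addr_ge0 ?mulr_ge0 ?exprn_ge0 ?invr_ge0 ?subr_ge0 ?(ltW r1).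
have hb2 : uadj b * (1 - v) = 1.
  by have := congr1 (@uadj R B) hb1; rewrite uadjM uadjB uadj1 sv.
have sb : uadj b = b by rewrite -[LHS]mulr1 -hb1 mulrA hb2 mul1r.
by exists b; split => //; rewrite -{1}sb.
Qed.

(* [v] is the limit of the iteration [c := (z + c^2) / 2]; starting at the exact
   scalar solution keeps the scalar part constant, so only [B] need be complete. *)
Lemma unit_sqrt z (r : R) : r < 1 -> bnd z r -> uadj z = z ->
  exists v, [/\ uadj v = v, bnd v r, v + v = z + v * v
    & forall c, z * c = c * z -> v * c = c * v].
Proof.
move=> r1 hz sz; have r0 := bnd_ge0 hz.
pose x : R := complex.Re z.1.
have zx : z.1 = x%:C by rewrite /x RRe_real//; apply/CrealP; rewrite -{2}sz.
have hx : `|x| <= r by case: hz => + _; rewrite zx rnorm_real.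
have [x1 x2] : - r <= x /\ x <= r by apply/andP; rewrite -ler_norml.
(* [1 - q] is the root of [2 c = x + c^2] with [|c| <= r]. *)
pose q : R := Num.sqrt (1 - x).
have q0 : 0 <= q by apply: sqrtr_ge0.
have qq : q * q = 1 - x by rewrite -expr2 sqr_sqrtr//; lra.
have [l0 l1] : - r <= 1 - q /\ 1 - q <= r by split; nra.
pose g n := iter n (fun c => (2^-1 : R)%:C *: (z + c * c)) (ur (1 - q)).
have gS n : g n.+1 = (2^-1 : R)%:C *: (z + g n * g n) by [].
have g1 n : (g n).1 = (1 - q)%:C.
  elim: n => [|n IH]; first exact: mulr1.
  rewrite gS /= IH zx -rmorphM -rmorphD; apply: etrans (esym (rmorphM _ _ _)) _.
  by congr (_%:C); nra.
have hg n : bnd (g n) r.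
  elim: n => [|n IH]; first by apply: (bnd_le (bndR _ _)); rewrite ler_norml l0 l1.
  have := bndZR 2^-1 (bndD hz (bndM IH IH)) => h.
  by apply: (bnd_le h); rewrite ger0_norm ?invr_ge0//; nra.
have diff a b : (2^-1 : R)%:C *: (z + a * a) - (2^-1 : R)%:C *: (z + b * b) =
    (2^-1 : R)%:C *: (a * (a - b) + (a - b) * b).
  rewrite -scalerBr opprD addrACA subrr add0r mulrBr mulrBl; congr (_ *: _).
  by rewrite addrA subrK.
have hdiff a b N : bnd a r -> bnd b r -> bnd (a - b) N ->
    bnd ((2^-1 : R)%:C *: (a * (a - b) + (a - b) * b)) (r * N).
  move=> ha hb hab.
  have := bndZR 2^-1 (bndD (bndM ha hab) (bndM hab hb)) => h.
  by apply: (bnd_le h); rewrite ger0_norm ?invr_ge0// [N * r]mulrC; lra.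
have [M hM] := bnd_exists (g 1%N - g 0%N); have M0 := bnd_ge0 hM.
have hgd n : bnd (g n.+1 - g n) (M * r ^+ n).
  elim: n => [|n IH]; first by rewrite expr0 mulr1.
  by rewrite [g n.+2]gS {3}[g n.+1]gS diff exprS mulrCA; apply: hdiff.
have [|v hv] := bnd_complete M0 r0 r1 _ hgd; first by move=> n; rewrite !g1.
have small e : 0 < e -> exists n, M * r ^+ n / (1 - r) < e.
  move=> e0; have [|n hn] := @geometric_small _ (M / (1 - r)) r e _ r0 r1 e0.
    by rewrite divr_ge0// subr_ge0 ltW.
  by exists n; rewrite mulrAC.
have bv : bnd v r.
  apply: bnd_lim => e /small[n hn]; rewrite addrC -[v](subrK (g n)).
  by apply: bndD => //; apply: (bnd_le (hv n)); apply: ltW.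
have hvv : v + v = z + v * v.
  suff : v - (2^-1 : R)%:C *: (z + v * v) = 0.
    by move/subr0_eq => {1 2}->; rewrite -scalerDr half_scale.
  apply: bnd_eq0; apply: bnd_lim => e e0; rewrite add0r.
  have [n hn] := small _ (divr_gt0 e0 (ltr0n _ 2)).
  rewrite -[v - _](subrKA (g n.+1)) (_ : e = e / 2 + e / 2); last by lra.
  apply: bndD.
    apply: (bnd_le (hv _)); apply: le_trans (ltW hn).
    rewrite exprS ler_wpM2r ?invr_ge0 ?subr_ge0 ?(ltW r1)// ler_wpM2l//.
    by rewrite ler_piMl ?exprn_ge0// ltW.
  rewrite gS diff; apply: (bnd_le (hdiff _ _ (e / 2) _ _ _)) => //.
    by rewrite -opprB; apply: bndN; apply: (bnd_le (hv _)); apply: ltW.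
  by rewrite ler_piMl ?(ltW r1)//; lra.
exists v; split=> //.
(* The adjoint of [v] solves the same equation as [v], and the difference of two solutions satisfies
   the equation of [sylvester0]. *)
- apply/eqP; rewrite -subr_eq0; apply/eqP.
  apply: (@sylvester0 (uadj v) v _ r) => //; first exact: bnd_adj.
  have ha : uadj v + uadj v = z + uadj v * uadj v by rewrite -uadjD hvv uadjD sz uadjM.
  rewrite addrACA ha -opprD hvv opprD addrACA subrr add0r mulrBr mulrBl.
  by rewrite addrA subrK.
(* Now the equation of [sylvester0] is that of the commutator [v c - c v]. *)
- move=> c hc; apply/eqP; rewrite -subr_eq0; apply/eqP.
  apply: (@sylvester0 v v _ r) => //.
  have h1 : v * c + v * c = z * c + v * v * c by rewrite -mulrDl hvv mulrDl.
  have h2 : c * v + c * v = c * z + c * (v * v) by rewrite -mulrDr hvv mulrDr.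
  rewrite addrACA h1 -opprD h2 opprD addrACA hc subrr add0r mulrBr mulrBl.
  by rewrite !mulrA addrA subrK.
Qed.

(* For self-adjoint [h] this says that the spectrum of [h] is nonnegative: the norm
   of [s - h] exceeds [s] by at most the largest element of the spectrum of [- h],
   in the limit of large [s]. *)
Definition pos h := uadj h = h /\
  forall e, 0 < e -> exists s, bnd (ur s - h) (s + e).

Lemma posD g h : pos g -> pos h -> pos (g + h).
Proof.
move=> [sg hg] [sh hh]; split=> [|e e0]; first by rewrite uadjD sg sh.
have e2 : 0 < e / 2 by lra.
have [s hs] := hg _ e2; have [t ht] := hh _ e2; exists (s + t).
rewrite urD opprD addrACA; apply: (bnd_le (bndD hs ht)); lra.
Qed.

Lemma posZ (c : R) h : 0 <= c -> pos h -> pos (c%:C *: h).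
Proof.
move=> c0 [sh hh]; split=> [|e e0]; first by rewrite uadjZR sh.
have c1 : 0 < c + 1 by lra.
have [s hs] := hh _ (divr_gt0 e0 c1); exists (c * s).
rewrite urZ -scalerBr; apply: (bnd_le (bndZR c hs)); rewrite ger0_norm//.
rewrite mulrDr lerD2l mulrCA ler_piMr ?ltW// ltr_pdivrMr//; lra.
Qed.

Lemma pos_ur s : 0 <= s -> pos (ur s).
Proof.
move=> s0; split=> [|e e0]; first exact: uadj_ur.
by exists s; rewrite subrr; apply: (bnd_le (bnd0 _)); lra.
Qed.

Lemma pos0 : pos 0. Proof. by rewrite -ur0; apply: pos_ur. Qed.

Lemma pos_lim h : (forall e, 0 < e -> pos (ur e + h)) -> pos h.
Proof.
move=> hh; split=> [|e e0].
  by have [+ _] := hh 1 ltr01; rewrite uadjD uadj_ur => /addrI.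
have e2 : 0 < e / 2 by lra.
have [_ /(_ _ e2)[s hs]] := hh _ e2; exists (s - e / 2).
by move: hs; rewrite urB opprD addrA => hs; apply: (bnd_le hs); lra.
Qed.

Lemma pos_bnd h M : uadj h = h -> bnd h M -> pos (ur M - h).
Proof.
move=> sh hh; split=> [|e e0]; first by rewrite uadjB uadj_ur sh.
by exists M; rewrite subKr; apply: (bnd_le hh); lra.
Qed.

Lemma ur_sqB (s : R) a :
  (ur s - a) * (ur s - a) + (s + s)%:C *: a = ur (s * s) + a * a.
Proof.
rewrite mulrBl !mulrBr !urMl !urMr -urZ scaleRD opprB.
by rewrite [X in X + _ = _]addrACA -opprD subrK.
Qed.

Lemma sub1_sq (v z : U) : v + v = z + v * v -> (1 - v) * (1 - v) = 1 - z.
Proof.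
move=> hv; have := ur_sqB 1 v; rewrite mulr1 ur1 scaleRD !scaleR1 hv addrA.
by move=> /addIr h; rewrite -[X in _ = X - z]h addrK.
Qed.

Lemma sqD_sqB a b :
  (a + b) * (a + b) - (a - b) * (a - b) = a * b + b * a + (a * b + b * a).
Proof.
by rewrite mulrBl !mulrBr mulrDl !mulrDr addr_polar.
Qed.

(** Take [s = 2 t^2] with [t] large. Adding a second self-adjoint square to the square of [s - h^2]
    leaves [4 t^4 + h^4], whose bound exceeds [s^2] by a constant only, while [(s + e)^2 - s^2]
    grows with [s]. *)
Lemma pos_sq h : uadj h = h -> pos (h * h).
Proof.
move=> sh; split=> [|e e0]; first by rewrite uadjM sh.
have [M hM] := bnd_exists h; have M0 := bnd_ge0 hM.
(* This choice ensures [M^4 <= t^2 e], as the final comparison with [(2 t^2 + e)^2] requires. *)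
pose t : R := (1 + M * M) * (1 + e^-1).
have t0 : 0 <= t by rewrite mulr_ge0 ?addr_ge0 ?mulr_ge0// invr_ge0 ltW.
have te : (M * M) ^+ 2 <= t * t * e.
  have e1 : (1 + e^-1) ^+ 2 * e = e + 2 + e^-1 by field; rewrite lt0r_neq0.
  have ei : 0 < e^-1 by rewrite invr_gt0.
  have -> : t * t * e = (1 + M * M) ^+ 2 * (e + 2 + e^-1) by rewrite -e1 /t; ring.
  have : 0 <= M * M by apply: mulr_ge0.
  by nra.
exists (2 * t ^+ 2).
(* [(2 t^2 - h^2)^2 + (2 t h)^2 = 4 t^4 + h^4] *)
apply: (@sum_sq_bnd _ ((2 * t)%:C *: h)).
- by rewrite uadjB uadj_ur uadjM sh.
- by rewrite uadjZR sh.
- by rewrite mulrBl mulrBr urMl urMr -!scalerAl -!scalerAr mulrA.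
- by have := exprn_ge0 2 t0; lra.
have -> : (ur (2 * t ^+ 2) - h * h) * (ur (2 * t ^+ 2) - h * h) +
    (2 * t)%:C *: h * ((2 * t)%:C *: h) = ur (4 * t ^+ 4) + h ^+ 4.
  have -> : (2 * t)%:C *: h * ((2 * t)%:C *: h) = (2 * t ^+ 2 + 2 * t ^+ 2)%:C *: (h * h).
    by rewrite -(scalerAl _ h) -(scalerAr _ h) scaleRA; congr (_%:C *: _); ring.
  rewrite ur_sqB; congr (ur _ + _); first by ring.
  by rewrite -!expr2 -exprM.
apply: (bnd_le (bndD (bndR _ _) (bndX 4 hM))).
rewrite ger0_norm; last by apply: mulr_ge0 => //; exact: exprn_ge0.
have -> : (2 * t ^+ 2 + e) ^+ 2 = 4 * t ^+ 4 + 4 * (t * t * e) + e ^+ 2 by ring.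
have -> : M ^+ 4 = (M * M) ^+ 2 by ring.
by have := sqr_ge0 (M * M); have := sqr_ge0 e; lra.
Qed.

(** [e + h = (s + e) (1 - z)] with [z = (s - h) / (s + e)], and [z] has a bound below 1 because
    [pos] gives [|s - h| <= s + e / 2]. So [w] is [sqrt (s + e)] times the root [1 - v] of [1 - z],
    and the shift by [e] makes it invertible. *)
Lemma pos_sqrt h (e : R) : pos h -> 0 < e -> exists w b,
  [/\ uadj w = w, w * w = ur e + h, (forall c, h * c = c * h -> w * c = c * w),
      uadj b = b & (w * b = 1 /\ b * w = 1)].
Proof.
move=> [sh hh] e0; have e2 : 0 < e / 2 by lra.
have [s hs] := hh _ e2; have s0 := bnd_ge0 hs.
have S0 : 0 < s + e by lra.
have r1 : (s + e)^-1 * (s + e / 2) < 1 by rewrite ltr_pdivrMl// mulr1; lra.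
have hz := bndZR (s + e)^-1 hs; rewrite ger0_norm ?invr_ge0 ?(ltW S0)// in hz.
have sz : uadj ((s + e)^-1%:C *: (ur s - h)) = (s + e)^-1%:C *: (ur s - h).
  by rewrite uadjZR uadjB uadj_ur sh.
have [v [sv bv hvv cv]] := unit_sqrt r1 hz sz.
have [b [sb wb bw]] := unit_inv r1 bv sv.
have q0 : 0 < Num.sqrt (s + e) by rewrite sqrtr_gt0.
have qq : Num.sqrt (s + e) * Num.sqrt (s + e) = s + e by rewrite -expr2 sqr_sqrtr// ltW.
exists ((Num.sqrt (s + e))%:C *: (1 - v)), ((Num.sqrt (s + e))^-1%:C *: b).
split; [| | | | split].
- by rewrite uadjZR uadjB uadj1 sv.
- rewrite -scalerAl -scalerAr scaleRA qq (sub1_sq hvv).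
  rewrite scalerBr scaleRA divff ?gt_eqF// scaleR1 opprB -/(ur _) addrA addrAC -urB.
  by congr (ur _ + _); ring.
- move=> c hc; rewrite -scalerAl -scalerAr mulrBl mulrBr mul1r mulr1; congr (_ *: (_ - _)).
  apply: cv; rewrite -scalerAl -scalerAr; congr (_ *: _).
  by rewrite mulrBl mulrBr urMl urMr hc.
- by rewrite uadjZR sb.
- by rewrite -scalerAl -scalerAr scaleRA wb divff ?gt_eqF// scaleR1.
- by rewrite -scalerAl -scalerAr scaleRA bw mulVf ?gt_eqF// scaleR1.
Qed.

(* [w v] is a square root of [(n + e)^2 - h^2]. *)
Lemma pos_between h (n : R) : 0 <= n -> pos (ur n - h) -> pos (ur n + h) -> bnd h n.
Proof.
move=> n0 pm pp; apply: bnd_lim => e e0.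
have sh : uadj h = h by case: pp; rewrite uadjD uadj_ur => /addrI.
have [w [_ [sw ww cw _ _]]] := pos_sqrt pp e0.
have [v [_ [sv vv cv _ _]]] := pos_sqrt pm e0.
have vh : v * h = h * v by apply: cv; rewrite mulrBl mulrBr urMl urMr.
have wh : w * h = h * w by apply: cw; rewrite mulrDl mulrDr urMl urMr.
have wv : w * v = v * w by apply: cw; rewrite mulrDl mulrDr urMl urMr vh.
apply: (@sum_sq_bnd _ (w * v)) => //.
- by rewrite uadjM sw sv wv.
- by rewrite mulrA -wh -!mulrA vh.
- by rewrite addr_ge0// ltW.
have -> : w * v * (w * v) = ur ((n + e) ^+ 2) - h * h.
  rewrite mulrA -[w * v * w]mulrA -wv mulrA ww -mulrA vv !addrA -urD.
  rewrite mulrDl !mulrBr !urMl !urMr -urZ subrKA.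
  by congr (ur _ - _); ring.
by rewrite addrC subrK; apply: (bnd_le (bndR _ _)); rewrite ger0_norm// exprn_ge0// addr_ge0// ltW.
Qed.

(** An exponential gain beats a linear factor; the exponents are powers of 2 to suit [bnd_pow2].
    With [d = e / q], squaring Bernoulli's inequality at [K = 2^k] produces [K^2 d^2], which
    dominates [2 K C]. *)
Lemma exp2_growth (C q e : R) : 0 <= C -> 0 < q -> 0 < e ->
  exists m, q ^+ (2 ^ m) * (1 + (2 ^ m)%:R * C) <= (q + e) ^+ (2 ^ m).
Proof.
move=> C0 q0 e0; pose d := e / q; have d0 : 0 < d by apply: divr_gt0.
have bern (k : nat) : 1 + k%:R * d <= (1 + d) ^+ k.
  elim: k => [|k IH]; first by rewrite mul0r addr0 expr0.
  rewrite exprS -natr1; have k0 : 0 <= k%:R :> R by apply: ler0n.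
  by nra.
have [k hk] : exists k : nat, 2 * C / d ^+ 2 <= k%:R.
  exists (Num.bound (2 * C / d ^+ 2)); apply/ltW/archi_boundP.
  by apply: divr_ge0; [apply: mulr_ge0|exact/exprn_ge0/ltW].
exists k.+1.
have -> : q + e = q * (1 + d) by rewrite /d mulrDr mulr1 mulrCA divff ?gt_eqF// mulr1.
rewrite exprMn ler_wpM2l ?exprn_ge0 ?(ltW q0)//.
rewrite expnSr exprM natrM; set K : R := (2 ^ k)%:R.
have hK : 2 * C / d ^+ 2 <= K.
  by apply: le_trans hk _; rewrite ler_nat ltnW// ltn_expl.
have K1 : 1 <= K by rewrite ler1n expn_gt0.
rewrite ler_pdivrMr ?exprn_gt0// in hK.
have := bern (2 ^ k)%N; rewrite -/K => hb.
have : (1 + K * d) ^+ 2 <= ((1 + d) ^+ (2 ^ k)) ^+ 2.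
  have Kd : 0 <= K * d by apply: mulr_ge0; lra.
  by rewrite ler_sqr ?nnegrE//; [lra|apply: exprn_ge0; lra].
apply: le_trans.
have : K * (2 * C) <= K * (K * d ^+ 2) by rewrite ler_wpM2l//; lra.
have : 0 <= K * d by rewrite mulr_ge0//; lra.
by nra.
Qed.

(* With [x = s - d^* d] one has [x^(k+1) = s x^k - d^* y^k d] where [y = s - d d^*], so
   the powers of [x] grow, up to a linear factor, at the rate given by [y]. *)
Lemma pos_swap d (n : R) : 0 <= n ->
  pos (d * uadj d + ur n) -> pos (uadj d * d + ur n).
Proof.
move=> n0 [_ hp]; split=> [|e e0]; first by rewrite uadjD uadjM uadjK uadj_ur.
have e2 : 0 < e / 2 by lra.
have [s0 hs0] := hp _ e2.
(* The extra [|s0 - n| + 1] makes [s >= 1], so that [|s| = s] in the recursion and [q] is positive;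
   the excess over [s] does not change. *)
pose s : R := (s0 - n) + (`|s0 - n| + 1).
have s1 : 1 <= s.
  by have := ler_norm (- (s0 - n)); rewrite normrN /s; lra.
pose q := s + n + e / 2.
have hY : bnd (ur s - d * uadj d) q.
  have t0 : 0 <= `|s0 - n| + 1 by rewrite addr_ge0.
  have := bndD hs0 (bndR B (`|s0 - n| + 1)); rewrite (ger0_norm t0) -/(ur _) => h.
  rewrite (_ : q = s0 + e / 2 + (`|s0 - n| + 1)); last by rewrite /q /s; ring.
  suff -> : ur s - d * uadj d = ur s0 - (d * uadj d + ur n) + ur (`|s0 - n| + 1) by [].
  by rewrite /s urD urB opprD addrA [LHS]addrAC [ur s0 - ur n - _]addrAC.
have q0 : 0 < q by rewrite /q; lra.
have [D hD] := bnd_exists d; have D0 := bnd_ge0 hD.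
pose x := ur s - uadj d * d.
have sx : uadj x = x by rewrite uadjB uadjM uadjK uadj_ur.
have dx (n1 : nat) : d * x ^+ n1 = (ur s - d * uadj d) ^+ n1 * d.
  elim: n1 => [|k IH]; first by rewrite !expr0 mulr1 mul1r.
  rewrite !exprS mulrA {1}/x mulrBr urMr -urMl mulrA -mulrBl.
  by rewrite -[LHS]mulrA IH mulrA.
pose C := D ^+ 2 / q.
have C0 : 0 <= C by rewrite divr_ge0 ?exprn_ge0// ltW.
have hx (k : nat) : bnd (x ^+ k) (q ^+ k * (1 + k%:R * C)).
  elim: k => [|k IH]; first by rewrite !expr0 mul0r addr0 mulr1; exact: bnd1.
  have -> : x ^+ k.+1 = s%:C *: x ^+ k - uadj d * ((ur s - d * uadj d) ^+ k * d).
    by rewrite exprS {1}/x mulrBl urMl -mulrA dx.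
  have := bndD (bndZR s IH) (bndN (bndM (bnd_adj hD) (bndM (bndX k hY) hD))).
  rewrite ger0_norm; last by lra.
  move=> h; apply: (bnd_le h).
  have -> : D * (q ^+ k * D) = q ^+ k.+1 * C.
    by rewrite /C exprS; field; rewrite gt_eqF.
  have -> : q ^+ k.+1 * (1 + k.+1%:R * C) = q * (q ^+ k * (1 + k%:R * C)) + q ^+ k.+1 * C.
    by rewrite exprS -natr1; ring.
  rewrite lerD2r ler_wpM2r//; last by rewrite /q; lra.
  exact: bnd_ge0 IH.
have bx : bnd x (q + e / 2).
  have [m hm] := exp2_growth C0 q0 e2.
  apply: (bnd_pow2 (m := m)) => //; first by rewrite addr_ge0// ltW.
  exact: bnd_le (hx _) hm.
exists (s + n); rewrite urD opprD addrACA subrr addr0.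
by apply: (bnd_le bx); rewrite /q; lra.
Qed.

Lemma posZV (c : R) h : 0 < c -> pos (c%:C *: h) -> pos h.
Proof.
move=> c0 hh; rewrite -[h]scaleR1 -(mulVf (lt0r_neq0 c0)) -scaleRA.
by apply: posZ => //; rewrite invr_ge0 ltW.
Qed.

(* With [w^2 = 1 - a] and [d = k w^n], the element [d^* d = w^n a w^n] is at most
   [1/(n+1)], as [t^n (1 - t) <= 1/(n+1)] on [t >= 0].  Since [d d^* + d^* d] is
   positive, [d d^*], hence [d^* d] by [pos_swap], is at least [- 1/(n+1)], and
   [a >= w^n a w^n]. *)
Lemma pos_adjM_small k a : a = uadj k * k -> bnd a (2^-1) -> pos a.
Proof.
move=> ak ha; have sa : uadj a = a by rewrite ak uadjM uadjK.
have r1 : 2^-1 < 1 :> R by lra.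
have [v [sv _ hvv cv]] := unit_sqrt r1 ha sa.
pose w := 1 - v.
have sw : uadj w = w by rewrite uadjB uadj1 sv.
have ww : w * w = 1 - a by apply: sub1_sq.
have wa : w * a = a * w by rewrite /w mulrBl mulrBr mul1r mulr1 cv.
have wna (n : nat) : w ^+ n * a = a * w ^+ n by apply: esym; apply: commrX.
pose X (n : nat) := w ^+ n * a * w ^+ n.
have wSE n y : w ^+ n.+1 * y * w ^+ n.+1 = w ^+ n * (w * y * w) * w ^+ n.
  by rewrite {1}exprSr exprS !mulrA.
have XS n : X n - X n.+1 = (a * w ^+ n) * (a * w ^+ n).
  rewrite /X wSE -mulrBl -mulrBr wa -[a * w * w]mulrA ww [a * (1 - a)]mulrBr mulr1.
  by rewrite subKr !mulrA wna.
have sX n : uadj (a * w ^+ n) = a * w ^+ n by rewrite uadjM uadjX sa sw wna.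
have p1 n : pos (a - X n).
  elim: n => [|n IH]; first by rewrite /X expr0 mul1r mulr1 subrr; exact: pos0.
  by rewrite -(subrKA (X n)) XS; apply: posD => //; apply: pos_sq.
(* With [t = w^2] this is [1 - t^(n+1) - (n+1) t^n (1 - t)], the sum over [j < n] of
   [(j+1) (X j - X (j+1))], and each difference is a square by [XS]. *)
have p2 n : pos (1 - w ^+ n.+1 * w ^+ n.+1 - n.+1%:R%:C *: X n).
  elim: n => [|n IH].
    by rewrite !expr1 ww subKr /X expr0 mul1r mulr1 scaleR1 subrr; exact: pos0.
  have -> : 1 - w ^+ n.+2 * w ^+ n.+2 - n.+2%:R%:C *: X n.+1 =
    (1 - w ^+ n.+1 * w ^+ n.+1 - n.+1%:R%:C *: X n) + n.+1%:R%:C *: (X n - X n.+1).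
    have -> : w ^+ n.+2 * w ^+ n.+2 = w ^+ n.+1 * w ^+ n.+1 - X n.+1.
      by rewrite {1}exprSr [w ^+ n.+2]exprS -mulrA [w * (w * _)]mulrA ww /X mulrBl mulrBr mul1r mulrA.
    rewrite opprB (addrCA 1) -[n.+2%:R]natr1 scaleRD scaleR1 scalerBr subrKA.
    by rewrite opprD [- _ - X n.+1]addrC [X n.+1 + _]addrC addrA addrK.
  by apply: posD => //; apply: posZ; rewrite ?ler0n// XS; apply: pos_sq.
apply: pos_lim => e e0.
have [n hn] : exists n : nat, e^-1 <= n.+1%:R.
  exists (Num.bound e^-1); apply: le_trans (ltW (archi_boundP _)) _.
    by rewrite invr_ge0 ltW.
  by rewrite ler_nat.
pose eta : R := n.+1%:R^-1.
have eta0 : 0 <= eta by rewrite invr_ge0 ler0n.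
have p3 : pos (ur eta - X n).
  have := posD (p2 n) (pos_sq (_ : uadj (w ^+ n.+1) = _)).
  rewrite uadjX sw => /(_ erefl); rewrite addrAC subrK => h.
  apply: (@posZV n.+1%:R); first by rewrite ltr0n.
  by rewrite scalerBr -urZ divff ?pnatr_eq0// ur1.
pose d := k * w ^+ n.
have Xd : X n = uadj d * d by rewrite /X uadjM uadjX sw ak !mulrA.
(* Twice this element is the sum of the squares of the self-adjoint elements [d + uadj d] and
   ['i (d - uadj d)]. *)
have p4 : pos (d * uadj d + uadj d * d).
  have sp : uadj (d + uadj d) = d + uadj d by rewrite uadjD uadjK addrC.
  have sq : uadj ('i%C *: (d - uadj d)) = 'i%C *: (d - uadj d).
    by rewrite uadjZ uadjB uadjK complexiE conjCi scaleNr -scalerN opprB.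
  have := posD (pos_sq sp) (pos_sq sq).
  rewrite -scalerAl -scalerAr scalerA -['i%C * 'i%C]expr2 sqr_i scaleN1r.
  rewrite sqD_sqB => h.
  by apply: (@posZV 2) => //; rewrite (_ : 2 = 1 + 1)// scaleRD !scaleR1.
have p5 : pos (d * uadj d + ur eta).
  by have := posD p4 p3; rewrite Xd addrACA subrr addr0.
have ee : 0 <= e - eta.
  by rewrite subr_ge0 -[e]invrK lef_pV2 ?posrE ?ltr0n ?invr_gt0.
have := posD (p1 n) (posD (pos_swap eta0 p5) (pos_ur ee)).
by rewrite -Xd urB -[X n + _ + _]addrA [ur eta + _]addrC subrK addrA subrK addrC.
Qed.

(** Scaling [k] by [c] reaches the range of [pos_adjM_small]: [c M <= 1/2] gives
    [(c M)^2 <= 1/2]. *)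
Lemma pos_adjM k : pos (uadj k * k).
Proof.
have [M hM] := bnd_exists k; have M0 := bnd_ge0 hM.
pose c : R := (2 * (M + 1))^-1.
have c0 : 0 < c by rewrite invr_gt0; lra.
have hc := bndZR c hM; rewrite ger0_norm ?ltW// in hc.
have cM : c * M <= 2^-1.
  by rewrite /c ler_pdivrMl; lra.
have := @pos_adjM_small (c%:C *: k) _ erefl; rewrite uadjZR -scalerAl -scalerAr scaleRA => h.
apply: (@posZV (c * c)); first exact: mulr_gt0.
apply: h; have := bndM (bnd_adj hc) hc.
rewrite uadjZR -scalerAl -scalerAr scaleRA => h; apply: (bnd_le h).
have : 0 <= c * M by rewrite mulr_ge0// ltW.
by nra.
Qed.

(** With [w^2 = f + h], conjugating by [q] gives the adjoint square of [w q], which is positive. The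
    choice [f = e / (M + 1)] keeps the error [f q^* q] below [e]. *)
Lemma pos_conj h q : pos h -> pos (uadj q * h * q).
Proof.
move=> hh; apply: pos_lim => e e0.
have [M hM] := bnd_exists (uadj q * q); have M0 := bnd_ge0 hM.
pose f : R := e / (M + 1).
have f0 : 0 < f by rewrite divr_gt0//; lra.
have fM : 0 <= e - f * M.
  rewrite subr_ge0 /f mulrAC ler_pdivrMr; last by lra.
  by rewrite ler_wpM2l ?ltW//; lra.
have [w [_ [sw ww _ _ _]]] := pos_sqrt hh f0.
have := posD (pos_adjM (w * q)) (posD (posZ (ltW f0) (pos_bnd _ hM)) (pos_ur fM)).
rewrite uadjM uadjK => /(_ erefl).
rewrite uadjM sw -mulrA [w * (w * q)]mulrA ww mulrDl mulrDr urMl -scalerAr.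
rewrite scalerBr -urZ urB [ur (f * M) - _]addrC -[- _ + _ + (_ - _)]addrA.
by rewrite [ur (f * M) + _]addrC subrK addrACA subrr add0r addrC mulrA.
Qed.

Lemma pos_dominated k m : (forall b M, bnd (k * b) M -> bnd (m * b) M) ->
  pos (uadj k * k - uadj m * m).
Proof.
move=> hkm; apply: pos_lim => e e0.
have [w [b [sw ww _ sb [wb bw]]]] := pos_sqrt (pos_adjM k) e0.
have hk : bnd (k * b) 1.
  apply: bnd_cstar; rewrite ?ler01// expr1n; apply: pos_between; rewrite ?ler01// ur1.
    (* [(k b)^* (k b) = b (w^2 - e) b = 1 - e b^2]. *)
    have -> : 1 - uadj (k * b) * (k * b) = e%:C *: (b * b).
      rewrite uadjM sb -mulrA [uadj k * (k * b)]mulrA.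
      have -> : uadj k * k = w * w - ur e by rewrite ww addrC addKr.
      rewrite mulrBl mulrBr urMl -scalerAr -[w * w * b]mulrA wb mulr1 bw.
      by rewrite subKr.
    by apply: posZ (pos_sq sb); exact: ltW.
  by rewrite -ur1; apply: posD; [apply: pos_ur; exact: ler01|exact: pos_adjM].
have hm := hkm _ _ hk; have := bndM (bnd_adj hm) hm; rewrite mulr1 => hmm.
(* Conjugation by [w] undoes [b] and turns [1 - (m b)^* (m b)] into [k^* k + e - m^* m]. *)
have := pos_conj w (pos_bnd _ hmm); rewrite uadjM uadjK => /(_ erefl).
rewrite ur1 mulrBr mulr1 mulrBl sw ww uadjM sb.
rewrite !mulrA wb mul1r -!mulrA bw mulr1 addrA.
by [].
Qed.

Lemma cstar_norm_eq (k m : B) : (forall b : B, rnorm (k ** b) = rnorm (m ** b)) ->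
  star k ** k = star m ** m.
Proof.
move=> hkm; apply/eqP; rewrite -subr_eq0; apply/eqP.
(* [B] is an ideal of its unitization: [bnd] tests [p c] on elements [y] of [B], and [c y] lies in
   [B] again, so the hypothesis on [B] reaches every [c]. *)
have dom (p q : B) : (forall b : B, rnorm (p ** b) = rnorm (q ** b)) ->
    forall (c : U) M, bnd (uinj p * c) M -> bnd (uinj q * c) M.
  move=> hpq c M [h1 h2]; split=> [|y]; first by move: h1; rewrite /= !mul0r.
  by move: (h2 y); rewrite !uactM !uact_uinj hpq.
have p1 := pos_dominated (dom _ _ hkm).
have p2 := pos_dominated (dom _ _ (fun b : B => esym (hkm b))).
have : bnd (uinj (star k ** k - star m ** m)) 0.
  apply: pos_between => //; rewrite ur0 ?sub0r ?add0r uinjB !uinjM -!uadj_uinj ?opprB//.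
by move=> /bnd_eq0 [].
Qed.

End Positivity.

(** * Generators of isometry groups *)

Section Limits.
Variable R : realType.

Definition tends0 (V : normedModType R[i]) (f : R -> V) (y : V) :=
  forall e, 0 < e -> exists2 d : R, 0 < d &
    forall t, t != 0 -> `|t| < d -> rnorm (f t - y) < e.

Lemma tends0P (V : normedModType R[i]) (f : R -> V) (y : V) :
  f t @[t --> (0 : R)^'] --> y <-> tends0 f y.
Proof.
split=> [/cvgrPdist_lt h e e0|h].
  have := h e%:C; rewrite ltcR => /(_ e0)[d /= d0 hd]; exists d => // t t0 td.
  have := hd t; rewrite /ball_ /= sub0r normrN => /(_ td t0).
  by rewrite rnormE ltcR rdistC.
apply/cvgrPdist_lt => e e0; have [d d0 hd] := h _ (Re_gt0 e0).
exists d => //= t; rewrite /= sub0r normrN => td t0.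
rewrite rnormE -[e]RRe_real; last by apply/ger0_real/ltW.
by rewrite ltcR rdistC; apply: hd.
Qed.

Variables (V W : normedModType R[i]).

Lemma tends0_le (f : R -> V) (g : R -> W) y z (K : R) : 0 <= K ->
  (forall t, t != 0 -> rnorm (g t - z) <= K * rnorm (f t - y)) ->
  tends0 f y -> tends0 g z.
Proof.
move=> K0 hK hf e e0; have K1 : 0 < K + 1 by lra.
have [d d0 hd] := hf _ (divr_gt0 e0 K1); exists d => // t t0 td.
apply: le_lt_trans (hK t t0) _.
have := hd t t0 td; rewrite ltr_pdivlMr//.
by have := rnorm_ge0 (f t - y); nra.
Qed.

Lemma tends0D (f g : R -> V) y z :
  tends0 f y -> tends0 g z -> tends0 (fun t => f t + g t) (y + z).
Proof.
move=> hf hg e e0; have e2 : 0 < e / 2 by lra.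
have [d1 d10 h1] := hf _ e2; have [d2 d20 h2] := hg _ e2.
exists (Num.min d1 d2); first by rewrite lt_min d10.
move=> t t0; rewrite lt_min => /andP[t1 t2].
rewrite opprD addrACA; apply: le_lt_trans (rnormD _ _) _.
by have := h1 t t0 t1; have := h2 t t0 t2; lra.
Qed.

Lemma tends0N (f : R -> V) y : tends0 f y -> tends0 (fun t => - f t) (- y).
Proof.
move=> hf e /hf[d d0 h]; exists d => // t t0 td.
by rewrite -opprD rnormN; apply: h.
Qed.

Lemma dense_approx (D : set V) x (e : R) : dense D -> 0 < e ->
  exists2 y, y \in D & rnorm (x - y) < e.
Proof.
move=> hD e0.
have [||y [hy Dy]] := hD (ball x e%:C).
- by exists x; apply: ballxx; rewrite ltcR.
- by apply: ball_open; rewrite ltcR.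
by exists y; [rewrite inE|apply/ball_rnorm].
Qed.

Lemma dense_eq (D : set V) (f g : V -> W) (K L : R) : dense D ->
  (forall x y, rnorm (f x - f y) <= K * rnorm (x - y)) ->
  (forall x y, rnorm (g x - g y) <= L * rnorm (x - y)) ->
  (forall x, x \in D -> f x = g x) -> forall x, f x = g x.
Proof.
move=> hD hf hg fg x; apply/eqP; rewrite -subr_eq0; apply/eqP/rnorm_eq0/eqP.
rewrite eq_le rnorm_ge0 andbT; apply/ler_addgt0Pr => e e0; rewrite add0r.
have K1 : 0 < `|K| + `|L| + 1 by have := normr_ge0 K; have := normr_ge0 L; lra.
have [y Dy hy] := dense_approx x hD (divr_gt0 e0 K1).
apply: le_trans (rdistD (f y) _ _) _; rewrite [X in _ + rnorm (X - _)]fg// [rnorm (g y - _)]rdistC.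
move: hy; rewrite ltr_pdivlMr// => hy.
have := hf x y; have := hg x y; have := rnorm_ge0 (x - y).
by have := ler_norm K; have := ler_norm L; nra.
Qed.

End Limits.

(** * The product rule for bounded bilinear maps *)

Section Bilinear.
Variables (R : realType) (V1 V2 W : normedModType R[i]).
Variables (m : V1 -> V2 -> W) (C : R).
Hypothesis mDl : forall x x' y, m (x + x') y = m x y + m x' y.
Hypothesis mDr : forall x y y', m x (y + y') = m x y + m x y'.
Hypothesis mZl : forall (t : R) x y, m (t%:C *: x) y = t%:C *: m x y.
Hypothesis mZr : forall (t : R) x y, m x (t%:C *: y) = t%:C *: m x y.
Hypothesis C0 : 0 <= C.
Hypothesis m_le : forall x y, rnorm (m x y) <= C * rnorm x * rnorm y.

Lemma bilinBl x x' y : m (x - x') y = m x y - m x' y.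
Proof. by rewrite mDl -scaleN1r -[-1](rmorphN1 (real_complex R)) mZl rmorphN1 scaleN1r. Qed.

Lemma bilinBr x y y' : m x (y - y') = m x y - m x y'.
Proof. by rewrite mDr -scaleN1r -[-1](rmorphN1 (real_complex R)) mZr rmorphN1 scaleN1r. Qed.

Lemma bilin_lipl y x x' : rnorm (m x y - m x' y) <= C * rnorm y * rnorm (x - x').
Proof. by rewrite -bilinBl mulrAC; apply: m_le. Qed.

Lemma bilin_lipr x y y' : rnorm (m x y - m x y') <= C * rnorm x * rnorm (y - y').
Proof. by rewrite -bilinBr; apply: m_le. Qed.

(** With [P], [Q] the difference quotients of [p], [q], that of the product is
    [m P y + m x Q + t m P Q]; the last term vanishes in the limit as [P] and [Q] stay bounded near
    0. *)
Lemma tends0_bilin (p : R -> V1) (q : R -> V2) x y x' y' :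
  tends0 (fun t => (t^-1)%:C *: (p t - x)) x' ->
  tends0 (fun t => (t^-1)%:C *: (q t - y)) y' ->
  tends0 (fun t => (t^-1)%:C *: (m (p t) (q t) - m x y)) (m x' y + m x y').
Proof.
move=> hp hq.
have h1 : tends0 (fun t => m ((t^-1)%:C *: (p t - x)) y) (m x' y).
  apply: (tends0_le (K := C * rnorm y)) hp => [|t _]; last exact: bilin_lipl.
  by rewrite mulr_ge0 ?rnorm_ge0.
have h2 : tends0 (fun t => m x ((t^-1)%:C *: (q t - y))) (m x y').
  apply: (tends0_le (K := C * rnorm x)) hq => [|t _]; last exact: bilin_lipr.
  by rewrite mulr_ge0 ?rnorm_ge0.
pose r t := t%:C *: m ((t^-1)%:C *: (p t - x)) ((t^-1)%:C *: (q t - y)).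
have h3 : tends0 r 0.
  move=> e e0; have [d1 d10 k1] := hp 1 ltr01; have [d2 d20 k2] := hq 1 ltr01.
  pose K := C * (rnorm x' + 1) * (rnorm y' + 1) + 1.
  have K0 : 0 < K.
    by rewrite /K ltr_wpDl// !mulr_ge0// addr_ge0 ?rnorm_ge0.
  exists (Num.min (Num.min d1 d2) (e / K)); first by rewrite !lt_min d10 d20 divr_gt0.
  move=> t t0; rewrite !lt_min => /andP[/andP[t1 t2] t3].
  rewrite subr0 /r rnormZR; move: t3; rewrite ltr_pdivlMr//; apply: le_lt_trans.
  rewrite ler_wpM2l//; apply: le_trans (m_le _ _) _.
  apply: (@le_trans _ _ (C * (rnorm x' + 1) * (rnorm y' + 1))); last by rewrite /K lerDl.
  apply: ler_pM; rewrite ?mulr_ge0 ?rnorm_ge0//.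
    rewrite ler_wpM2l//.
    have := rnormD ((t^-1)%:C *: (p t - x) - x') x'; rewrite subrK.
    by have := k1 t t0 t1; lra.
  have := rnormD ((t^-1)%:C *: (q t - y) - y') y'; rewrite subrK.
  by have := k2 t t0 t2; lra.
have := tends0D (tends0D h1 h2) h3; rewrite addr0.
move=> h e /h[d d0 hd]; exists d => // t t0 td; have := hd t t0 td.
congr (rnorm (_ - _) < _).
have rt : r t = (t^-1)%:C *: m (p t - x) (q t - y).
  by rewrite /r mZl mZr scalerA -rmorphM divff// rmorph1 scale1r.
rewrite rt mZl mZr -!scalerDr; congr (_ *: _).
rewrite [m (p t - x) (q t - y)]bilinBr addrC addrA subrK.
by rewrite bilinBl bilinBr subrKA.
Qed.

End Bilinear.

(** * Groups of isometries: constant curves, closedness of the generator, cores *)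

Section Group.
Variables (R : realType) (V : completeNormedModType R[i]).
Variable u : R -> V -> V.
Hypothesis hu : is_C0_group u.

Lemma group0 x : u 0 x = x. Proof. by case: hu => -[]. Qed.
Lemma groupD s t x : u (s + t) x = u s (u t x). Proof. by case: hu => -[]. Qed.
Lemma groupNK t x : u (- t) (u t x) = x. Proof. by rewrite -groupD addNr group0. Qed.
Lemma groupKN t x : u t (u (- t) x) = x. Proof. by rewrite -groupD addrN group0. Qed.
Lemma groupC s t x : u s (u t x) = u t (u s x).
Proof. by rewrite -!groupD addrC. Qed.

Lemma group_linD t x y : u t (x + y) = u t x + u t y.
Proof. by case: hu => _ _ /(_ t 1 x y); rewrite !scale1r. Qed.
Lemma group_lin0 t : u t 0 = 0.
Proof. by apply: (addIr (u t 0)); rewrite -group_linD !add0r. Qed.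
Lemma group_linZ t (l : R[i]) x : u t (l *: x) = l *: u t x.
Proof. by case: hu => _ _ /(_ t l x 0); rewrite group_lin0 !addr0. Qed.
Lemma group_linB t x y : u t (x - y) = u t x - u t y.
Proof. by rewrite group_linD -scaleN1r group_linZ scaleN1r. Qed.
Lemma rnorm_group t x : rnorm (u t x) = rnorm x.
Proof. by case: hu => _ _ _ h; rewrite /rnorm h. Qed.
Lemma rdist_group t x y : rnorm (u t x - u t y) = rnorm (x - y).
Proof. by rewrite -group_linB rnorm_group. Qed.

Lemma group_cvg0 x (e : R) : 0 < e ->
  exists2 d : R, 0 < d & forall s, `|s| < d -> rnorm (u s x - x) < e.
Proof.
move=> e0; case: hu => _ /(_ x 0) + _ _.
move=> /cvgrPdist_lt/(_ e%:C); rewrite ltcR => /(_ e0)[d /= d0 hd].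
exists d => // s sd; have := hd s; rewrite /= sub0r normrN => /(_ sd).
by rewrite group0 rnormE ltcR rdistC.
Qed.

(** The curve [F s = u_-s (m (g_s x))] has derivative zero by the hypothesis at [g_s x]. Constancy
    is read off the real function [G s = |F s - F 0|], whose increments are bounded by those of [F].
    Since [m] is any map, [X] can be a product carrying a bilinear one. *)
Lemma flow_intertwine (X : Type) (g : R -> X -> X) (D : X -> Prop) (m : X -> V) :
  (forall x, g 0 x = x) -> (forall s t x, g (s + t) x = g s (g t x)) ->
  (forall t x, D x -> D (g t x)) ->
  (forall x, D x -> tends0 (fun t => (t^-1)%:C *: (u t (m x) - m (g t x))) 0) ->
  forall t x, D x -> u t (m x) = m (g t x).
Proof.
move=> g0 gD hD hm t x Dx.
pose F s := u (- s) (m (g s x)).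
pose G s : R := rnorm (F s - F 0).
have hF s h : rnorm (F (s + h) - F s) = rnorm (u h (m (g s x)) - m (g h (g s x))).
  by rewrite /F opprD groupD rdist_group [s + h]addrC gD -(rdist_group h) groupKN rdistC.
suff : G t = G 0.
  rewrite /G subrr rnorm0 => /rnorm_eq0/subr0_eq; rewrite /F oppr0 !group0 g0.
  by move=> <-; rewrite groupKN.
apply: (@is_derive_0_is_cst R G) => s.
have : h^-1 *: ((G \o shift s) (h *: (1 : R)) - G s) @[h --> (0 : R)^'] --> (0 : R).
  apply/cvgrPdist_lt => e e0; have [d d0 hd] := hm _ (hD s _ Dx) e e0.
  exists d => //= h; rewrite /= sub0r normrN => hh h0; rewrite sub0r normrN.
  have := hd h h0 hh; rewrite subr0 rnormZR; apply: le_lt_trans.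
  rewrite normrM ler_wpM2l// -hF /G /= [h *: 1]mulr1 [h + s]addrC.
  have := rdistD (F (s + h)) (F s) (F 0); have := rdistD (F s) (F (s + h)) (F 0).
  by rewrite [rnorm (F s - F (s + h))]rdistC ler_norml => ? ?; apply/andP; split; lra.
move=> h; split; first by apply/cvg_ex; exists 0.
by apply/cvg_lim.
Qed.

Variable d : linop V.
Hypothesis hd : is_generator d u.

Lemma generatorP x y : x \in dom d /\ d x = y <->
  tends0 (fun t => (t^-1)%:C *: (u t x - x)) y.
Proof.
rewrite hd -tends0P; apply: iff_trans (iff_refl _) _.
by under eq_fun do rewrite -fmorphV.
Qed.

Lemma generator_tends0 x : x \in dom d ->
  tends0 (fun t => (t^-1)%:C *: (u t x - x)) (d x).
Proof. by move=> dx; apply/generatorP. Qed.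

Lemma generator_group t x : x \in dom d -> u t x \in dom d /\ d (u t x) = u t (d x).
Proof.
move=> dx; apply/generatorP; apply: (tends0_le (K := 1)) (generator_tends0 dx) => // s _.
by rewrite mul1r groupC -group_linB -group_linZ rdist_group.
Qed.

Lemma linop0 : d 0 = 0.
Proof.
have [h0 _] := dom_submod d.
by have := lop_linear (-1) h0 h0; rewrite scaler0 addr0 scaleN1r addNr.
Qed.

Lemma domD x y : x \in dom d -> y \in dom d -> x + y \in dom d /\ d (x + y) = d x + d y.
Proof.
move=> dx dy; have [_ /(_ 1 _ _ dx dy)] := dom_submod d.
by have := lop_linear 1 dx dy; rewrite !scale1r.
Qed.

Lemma domZ (l : R[i]) x : x \in dom d -> l *: x \in dom d /\ d (l *: x) = l *: d x.
Proof.
move=> dx; have [h0 /(_ l _ _ dx h0)] := dom_submod d.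
by have := lop_linear l dx h0; rewrite linop0 !addr0.
Qed.

Lemma dom_sum n (f : nat -> V) : (forall j, f j \in dom d) ->
  (\sum_(j < n) f j) \in dom d /\ d (\sum_(j < n) f j) = \sum_(j < n) d (f j).
Proof.
move=> hf; elim: n => [|n [IH1 IH2]].
  by rewrite !big_ord0 linop0; have [] := dom_submod d.
by rewrite !big_ord_recr /= -IH2; apply: domD.
Qed.

Lemma generator_small_step x (t e : R) : x \in dom d -> 0 < e -> t != 0 ->
  exists n, let h := t / n.+1%:R in rnorm (u h x - x - h%:C *: d x) <= `|h| * e.
Proof.
move=> dx e0 t0; have [k k0 hk] := generator_tends0 dx e0.
exists (Num.bound (`|t| / k)) => h.
have h0 : h != 0 by rewrite mulf_neq0// invr_eq0 pnatr_eq0.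
have hlt : `|h| < k.
  rewrite normrM normfV normr_nat.
  rewrite ltr_pdivrMr ?ltr0n// mulrC -ltr_pdivrMr//.
  apply: lt_le_trans (archi_boundP _) _; first by rewrite divr_ge0// ltW.
  by rewrite ler_nat.
have -> : u h x - x - h%:C *: d x = h%:C *: ((h^-1)%:C *: (u h x - x) - d x).
  by rewrite scalerBr scalerA -rmorphM divff// rmorph1 scale1r.
by rewrite rnormZR ler_wpM2l// ltW// hk.
Qed.

(** Stands for the obvious bound of the integral of [u_s (d x) - d x] from 0 to [t]. The interval is
    cut into equal steps [h], each with error at most [|h| (K + e)], and [e] is arbitrary. *)
Lemma generator_mean_value x (t K : R) : x \in dom d ->
  (forall s, `|s| <= `|t| -> rnorm (u s (d x) - d x) <= K) ->
  rnorm (u t x - x - t%:C *: d x) <= `|t| * K.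
Proof.
move=> dx hK; have [->|t0] := eqVneq t 0.
  by rewrite group0 subrr scale0r subr0 rnorm0 normr0 mul0r.
suff hs e : 0 < e -> rnorm (u t x - x - t%:C *: d x) <= `|t| * (K + e).
  apply/ler_addgt0Pr => e e0; have ta : 0 < `|t| by rewrite normr_gt0.
  by have := hs _ (divr_gt0 e0 ta); rewrite mulrDr [_ * (e / _)]mulrC divfK ?normr_eq0.
move=> e0; have [n hn] := generator_small_step dx e0 t0.
pose h := t / n.+1%:R; rewrite -/h in hn.
have ht : h * n.+1%:R = t by rewrite divfK// pnatr_eq0.
move: hn => /= hn; clearbody h.
have step (j : nat) : (j <= n.+1)%N ->
    rnorm (u (h * j%:R) x - x - (h * j%:R)%:C *: d x) <= `|h * j%:R| * (K + e).
  elim: j => [|j IH] jn.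
    by rewrite mulr0 group0 subrr scale0r subr0 rnorm0 normr0 mul0r.
  set s := h * j%:R in IH *.
  have hs : `|s| <= `|t|.
    by rewrite /s -ht !normrM !normr_nat ler_wpM2l// ler_nat ltnW.
  have sh : h * j.+1%:R = s + h by rewrite -natr1 mulrDr mulr1.
  have shn : `|s + h| = `|s| + `|h|.
    by rewrite -sh /s !normrM !normr_nat -natr1 mulrDr mulr1.
  rewrite sh shn.
  (* In one step [u_s] carries the small-step error isometrically, and replacing [u_s (d x)] by
     [d x] costs at most [|h| K]. *)
  have -> : u (s + h) x - x - (s + h)%:C *: d x =
      (u s x - x - s%:C *: d x) +
      (u s (u h x - x - h%:C *: d x) + h%:C *: (u s (d x) - d x)).
    rewrite groupD !group_linB group_linZ scalerBr subrKA addrACA.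
    by rewrite [X in _ = X + _]addrC subrKA -opprD rmorphD scalerDl.
  apply: le_trans (rnormD _ _) _; rewrite mulrDl lerD//; first exact/IH/ltnW.
  apply: le_trans (rnormD _ _) _; rewrite rnorm_group rnormZR mulrDr addrC lerD//.
  by rewrite ler_wpM2l// hK.
by have := step n.+1 (leqnn _); rewrite ht.
Qed.

(** For the approximants [z] the bound of [generator_mean_value] is uniform: [u_s (d z) - d z] is
    controlled by [u_s y - y]. So the difference quotient of [x] itself is close to [y]. *)
Lemma generator_closed x y :
  (forall e, 0 < e -> exists z, [/\ z \in dom d, rnorm (z - x) < e & rnorm (d z - y) < e]) ->
  x \in dom d /\ d x = y.
Proof.
move=> h; apply/generatorP => e e0.
have e4 : 0 < e / 5 by lra.
have [k k0 hk] := group_cvg0 y e4; exists k => // t t0 tk.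
have ta : 0 < `|t| by rewrite normr_gt0.
(* [z] is chosen after [t], since [|z - x|] must be small against [|t|], by which the quotient
   divides. *)
have m0 : 0 < Num.min (e / 5) (`|t| * (e / 10)).
  by rewrite lt_min e4 mulr_gt0//; lra.
have [z [dz]] := h _ m0; rewrite !lt_min => /andP[zx1 zx2] /andP[zy1 zy2].
have mv : rnorm (u t z - z - t%:C *: d z) <= `|t| * (3 * (e / 5)).
  apply: generator_mean_value => // s st.
  have := rdistD (u s y) (u s (d z)) (d z); rewrite rdist_group.
  have := rdistD y (u s y) (d z).
  by have := hk s (le_lt_trans st tk); rewrite [rnorm (y - d z)]rdistC; lra.
have -> : (t^-1)%:C *: (u t x - x) - y = 
    (t^-1)%:C *: (u t z - z - t%:C *: d z) + (d z - y)
    - (t^-1)%:C *: ((u t z - u t x) - (z - x)).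
  have -> : (t^-1)%:C *: (u t z - z - t%:C *: d z) = (t^-1)%:C *: (u t z - z) - d z.
    by rewrite [LHS]scalerBr scalerA -rmorphM mulVf// rmorph1 scale1r.
  rewrite subrKA addrAC -scalerBr; congr (_ *: _ - _).
  by rewrite opprB addrA subrKA opprB addrC subrKA.
apply: le_lt_trans (rnormD _ _) _; rewrite rnormN.
have h1 := rnormD ((t^-1)%:C *: (u t z - z - t%:C *: d z)) (d z - y).
have h2 : rnorm ((t^-1)%:C *: (u t z - z - t%:C *: d z)) <= 3 * (e / 5).
  by rewrite rnormZR normfV ler_pdivrMl.
have h3 : rnorm ((t^-1)%:C *: (u t z - u t x - (z - x))) < e / 5.
  rewrite rnormZR normfV ltr_pdivrMl//; apply: le_lt_trans (rnormD _ _) _.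
  by rewrite rnormN rdist_group; lra.
by lra.
Qed.

(* [z] is a Riemann sum of [(1/t) int_0^t u_s y ds] for some [y] in [D] close to [x],
   and [d z] is close to [(u_t y - y) / t]. *)
Lemma generator_core (D : set V) x (e : R) :
  dense D -> D `<=` dom d -> submod_closed [in D] ->
  (forall t y, y \in D -> u t y \in D) -> x \in dom d -> 0 < e ->
  exists z, [/\ z \in D, rnorm (z - x) < e & rnorm (d z - d x) < e].
Proof.
move=> hD Dd [D0 Dlin] Du dx e0; pose f := e / 6; have f0 : 0 < f by rewrite /f; lra.
have [k1 k10 hk1] := group_cvg0 x f0; have [k2 k20 hk2] := generator_tends0 dx f0.
pose t := Num.min k1 k2 / 2.
have m0 : 0 < Num.min k1 k2 by rewrite lt_min k10.
have t0 : 0 < t by rewrite /t; lra.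
have tn : t != 0 by rewrite gt_eqF.
have : t < Num.min k1 k2 by rewrite /t; lra.
rewrite lt_min => /andP[t1 t2].
(* The bound [t * f] survives the division by [t] when [y] replaces [x] in the difference
   quotient. *)
have f1 : 0 < Num.min f (t * f) by rewrite lt_min f0 mulr_gt0.
have [y Dy] := dense_approx x hD f1; rewrite lt_min => /andP[y1 y2].
have dy : y \in dom d by move: Dy; rewrite !inE; exact: Dd.
have [n] := generator_small_step dy f0 tn; set h := t / _ => /= hn.
have h0 : 0 < h by rewrite divr_gt0.
have th : t^-1 * h = n.+1%:R^-1 by rewrite /h mulrA mulVf// mul1r.
have ht : h * n.+1%:R = t by rewrite divfK// pnatr_eq0.
pose N : R := n.+1%:R; have N0 : 0 < N by rewrite ltr0n.
have Nn : N != 0 by rewrite gt_eqF.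
pose S w := \sum_(j < n.+1) u (h * j%:R) w.
have rS w : rnorm (S w) <= N * rnorm w.
  rewrite /S /N; elim: (n.+1) => [|p IH]; first by rewrite big_ord0 rnorm0 mul0r.
  rewrite big_ord_recr /= -natr1 mulrDl mul1r; apply: le_trans (rnormD _ _) _.
  by rewrite rnorm_group lerD2r.
have SB v w : S (v - w) = S v - S w.
  by rewrite /S -sumrB; apply: eq_bigr => j _; rewrite group_linB.
have SZ (l : R[i]) w : S (l *: w) = l *: S w.
  by rewrite /S scaler_sumr; apply: eq_bigr => j _; rewrite group_linZ.
(* The sum telescopes: a discrete form of the fact that [d] maps the integral of [u_s y] from 0 to
   [t] to [u_t y - y]. *)
have tele : S (u h y - y) = u t y - y.
  rewrite /S -ht; elim: (n.+1) => [|p IH]; first by rewrite big_ord0 mulr0 group0 subrr.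
  rewrite big_ord_recr /= IH group_linB -groupD -natr1 mulrDr mulr1.
  by rewrite addrC subrKA.
have Su : rnorm (S y - N%:C *: y) <= N * (3 * f).
  have hb (j : nat) : (j < n.+1)%N -> rnorm (u (h * j%:R) y - y) <= 3 * f.
    move=> jn; have hj : `|h * j%:R| < k1.
      rewrite ger0_norm; last by rewrite mulr_ge0// ltW.
      by apply: lt_trans t1; rewrite -ht ltr_pM2l// ltr_nat.
    have := rdistD (u (h * j%:R) x) (u (h * j%:R) y) y; rewrite rdist_group.
    have := rdistD x (u (h * j%:R) x) y; have := hk1 _ hj.
    by rewrite [rnorm (y - x)]rdistC; lra.
  rewrite /S /N; elim: (n.+1) hb => [|p IH] hb.
    by rewrite big_ord0 scale0r subrr rnorm0 mul0r.
  rewrite big_ord_recr /= -natr1 rmorphD scalerDl rmorph1 scale1r opprD addrACA.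
  apply: le_trans (rnormD _ _) _; rewrite mulrDl mul1r lerD//.
    by apply: IH => j jp; apply: hb; apply: ltnW.
  exact: hb.
pose z := (N^-1)%:C *: S y.
have DS : S y \in D.
  rewrite /S; elim: (n.+1) => [|p IH]; first by rewrite big_ord0.
  by rewrite big_ord_recr /= -[X in X + _]scale1r; apply: Dlin => //; apply: Du.
have Dz : z \in D by rewrite /z -[_ *: _]addr0; apply: Dlin.
have [dS dSe] := @dom_sum n.+1 (fun j => u (h * j%:R) y) (fun j => proj1 (generator_group _ dy)).
have dz : d z = (N^-1)%:C *: S (d y).
  rewrite /z (proj2 (domZ _ dS)) dSe; congr (_ *: _); apply: eq_bigr => j _.
  exact: (proj2 (generator_group _ dy)).
have zx : rnorm (z - y) <= 3 * f.
  have -> : z - y = (N^-1)%:C *: (S y - N%:C *: y).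
    by rewrite scalerBr scalerA -rmorphM mulVf// rmorph1 scale1r.
  by rewrite rnormZR normfV (ger0_norm (ltW N0)) ler_pdivrMl.
(* Three errors: the small-step errors summed by [S], the replacement of [y] by [x], and the
   difference quotient of [x]. In the first, [h / t = 1 / N] makes [S (h d y) / t] equal to
   [d z]. *)
have E : d z - d x = - (t^-1)%:C *: S (u h y - y - h%:C *: d y)
   + ((t^-1)%:C *: ((u t y - u t x) - (y - x)) + ((t^-1)%:C *: (u t x - x) - d x)).
  rewrite SB tele SZ scaleNr scalerBr scalerA -rmorphM.
  rewrite th.
  rewrite -dz opprB [_ *: _ + (_ *: _ - d x)]addrA -scalerDr.
  by rewrite opprB [_ + (u t x - x)]addrAC !subrKA.
exists z; split=> //.
  by apply: le_lt_trans (rdistD y _ _) _; rewrite [rnorm (y - x)]rdistC /f in zx y1 *; lra.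
rewrite E; apply: le_lt_trans (rnormD _ _) _.
have h1 : rnorm (- (t^-1)%:C *: S (u h y - y - h%:C *: d y)) <= f.
  rewrite -rmorphN rnormZR normrN normfV (ger0_norm (ltW t0)) ler_pdivrMl//.
  move: hn; rewrite (ger0_norm (ltW h0)) => hn.
  apply: le_trans (rS _) _; apply: le_trans (ler_wpM2l (ltW N0) hn) _.
  by rewrite -ht mulrCA mulrA.
have h2 : rnorm ((t^-1)%:C *: (u t y - u t x - (y - x))) <= 2 * f.
  rewrite rnormZR normfV (ger0_norm (ltW t0)) ler_pdivrMl//.
  apply: le_trans (rnormD _ _) _; rewrite rnormN rdist_group rdistC.
  by move: y2; lra.
have h3 : rnorm ((t^-1)%:C *: (u t x - x) - d x) < f.
  by apply: hk2 => //; rewrite ger0_norm// ltW.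
have := rnormD ((t^-1)%:C *: (u t y - u t x - (y - x))) ((t^-1)%:C *: (u t x - x) - d x).
by rewrite /f in h1 h2 h3 *; lra.
Qed.

End Group.

(** * Leibniz rules for generators and multiplicativity of groups *)

Section Intertwining.
Variables (R : realType) (V1 V2 W : completeNormedModType R[i]).
Variables (m : V1 -> V2 -> W) (C : R).
Hypothesis mDl : forall x x' y, m (x + x') y = m x y + m x' y.
Hypothesis mDr : forall x y y', m x (y + y') = m x y + m x y'.
Hypothesis mZl : forall (t : R) x y, m (t%:C *: x) y = t%:C *: m x y.
Hypothesis mZr : forall (t : R) x y, m x (t%:C *: y) = t%:C *: m x y.
Hypothesis C0 : 0 <= C.
Hypothesis m_le : forall x y, rnorm (m x y) <= C * rnorm x * rnorm y.
Variables (u1 : R -> V1 -> V1) (u2 : R -> V2 -> V2) (v : R -> W -> W).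
Variables (d1 : linop V1) (d2 : linop V2) (d : linop W).
Hypotheses (hu1 : is_C0_group u1) (hu2 : is_C0_group u2) (hv : is_C0_group v).
Hypotheses (hd1 : is_generator d1 u1) (hd2 : is_generator d2 u2).
Hypothesis hd : is_generator d v.

(** The pair of [u1] and [u2] is a flow on the product space, and by the Leibniz rule [m] has the
    same derivative along it as along [v]. Boundedness of [m] extends the identity from the domains,
    one variable at a time. *)
Lemma leibniz_intertwine : dense (dom d1) -> dense (dom d2) ->
  (forall x y, x \in dom d1 -> y \in dom d2 ->
     m x y \in dom d /\ d (m x y) = m (d1 x) y + m x (d2 y)) ->
  forall t x y, v t (m x y) = m (u1 t x) (u2 t y).
Proof.
move=> den1 den2 leib t.
have main x y : x \in dom d1 -> y \in dom d2 -> v t (m x y) = m (u1 t x) (u2 t y).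
  move=> dx dy.
  apply: (@flow_intertwine _ _ _ hv (V1 * V2)%type (fun s p => (u1 s p.1, u2 s p.2))
    (fun p => p.1 \in dom d1 /\ p.2 \in dom d2) (fun p => m p.1 p.2) _ _ _ _ t (x, y)) => //.
  - by move=> [a b] /=; rewrite (group0 hu1) (group0 hu2).
  - by move=> s r [a b] /=; rewrite (groupD hu1) (groupD hu2).
  - move=> s [a b] /= [da db]; split.
      exact: (proj1 (generator_group hu1 hd1 _ da)).
    exact: (proj1 (generator_group hu2 hd2 _ db)).
  - move=> [a b] /= [da db]; have [dm em] := leib _ _ da db.
    have h1 := generator_tends0 hd dm.
    have h2 := tends0_bilin mDl mDr mZl mZr C0 m_le
      (generator_tends0 hd1 da) (generator_tends0 hd2 db).
    have := tends0D h1 (tends0N h2); rewrite em subrr.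
    move=> h e /h[k k0 hk]; exists k => // s s0 sk; have := hk s s0 sk.
    by rewrite -scalerBr opprB subrKA.
have mainr x y : y \in dom d2 -> v t (m x y) = m (u1 t x) (u2 t y).
  move=> dy; move: x; apply: (dense_eq (K := C * rnorm y) (L := C * rnorm (u2 t y)) den1).
  - by move=> a b; rewrite (rdist_group hv); apply: (bilin_lipl mDl mZl m_le).
  - move=> a b; rewrite -[rnorm (a - b)](rdist_group hu1 t).
    exact: (bilin_lipl mDl mZl m_le).
  - by move=> a da; apply: main.
move=> x; apply: (dense_eq (K := C * rnorm x) (L := C * rnorm (u1 t x)) den2).
- by move=> a b; rewrite (rdist_group hv); apply: (bilin_lipr mDr mZr m_le).
- move=> a b; rewrite -[rnorm (a - b)](rdist_group hu2 t).
  exact: (bilin_lipr mDr mZr m_le).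
- by move=> b db; apply: mainr.
Qed.

Lemma intertwine_leibniz : (forall t x y, v t (m x y) = m (u1 t x) (u2 t y)) ->
  forall x y, x \in dom d1 -> y \in dom d2 ->
    m x y \in dom d /\ d (m x y) = m (d1 x) y + m x (d2 y).
Proof.
move=> hm x y dx dy; apply/(generatorP hd).
have := tends0_bilin mDl mDr mZl mZr C0 m_le
  (generator_tends0 hd1 dx) (generator_tends0 hd2 dy).
by move=> h e /h[k k0 hk]; exists k => // s s0 sk; rewrite hm; apply: hk.
Qed.

End Intertwining.

(** * Linear spans, density and closures of graphs in terms of norms *)

Section LinSpan.
Variables (R : realType) (V : normedModType R[i]).

Lemma lin_span_ind (S : set V) (P : V -> Prop) : P 0 ->
  (forall (a : R[i]) x y, P x -> P y -> P (a *: x + y)) ->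
  (forall x, x \in S -> P x) -> forall x, x \in lin_span S -> P x.
Proof.
move=> P0 Plin PS x; rewrite inE => -[n [l [s [hs ->]]]].
elim: n l s hs => [|n IH] l s hs; first by rewrite big_ord0.
rewrite big_ord_recl; apply: Plin; first exact/PS/hs.
exact: (IH (fun i => l (lift ord0 i)) (fun i => s (lift ord0 i))).
Qed.

Lemma lin_span_lin (S : set V) (a : R[i]) x y :
  x \in lin_span S -> y \in lin_span S -> a *: x + y \in lin_span S.
Proof.
rewrite !inE => -[n [l [s [hs ->]]]] [p [l' [s' [hs' ->]]]].
exists (n + p)%N, (fun i => match split i with inl j => a * l j | inr j => l' j end),
  (fun i => match split i with inl j => s j | inr j => s' j end); split.
  by move=> i; case: (split i).
rewrite big_split_ord /= scaler_sumr; congr (_ + _); apply: eq_bigr => i _.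
  by rewrite -[lshift p i]/(unsplit (inl i)) unsplitK scalerA.
by rewrite -[rshift n i]/(unsplit (inr i)) unsplitK.
Qed.

Lemma lin_span0 (S : set V) : 0 \in lin_span S.
Proof.
rewrite inE; exists 0%N, (fun => 0), (fun => 0); split; first by case.
by rewrite big_ord0.
Qed.

Lemma mem_lin_span (S : set V) x : x \in S -> x \in lin_span S.
Proof.
move=> Sx; rewrite inE; exists 1%N, (fun => 1), (fun => x); split => //.
by rewrite big_ord1 scale1r.
Qed.

Lemma approx_dense (D : set V) :
  (forall x e, 0 < e -> exists2 y, y \in D & rnorm (x - y) < e) -> dense D.
Proof.
move=> h O [x Ox] oO; have /nbhs_ballP[e /= e0 he] := open_nbhs_nbhs (conj oO Ox).
have [y Dy xy] := h x _ (Re_gt0 e0); exists y; split; last by rewrite inE in Dy.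
by apply/he/ball_rnorm'.
Qed.

Lemma closure_graph (d : linop V) (D : set V) p :
  closure (graph_on d D) p <-> forall e, 0 < e -> exists z,
    [/\ z \in D, rnorm (z - p.1) < e & rnorm (d z - p.2) < e].
Proof.
split=> [h e e0|h N /nbhs_ballP[e /= e0 he]].
  have eC : 0 < e%:C by rewrite ltcR.
  have [[z w] [[/= Dz ->] [/= /ball_rnorm h1 /ball_rnorm h2]]] := h _ (nbhsx_ballx p _ eC).
  by exists z; split=> //; rewrite rdistC.
have [z [Dz z1 z2]] := h _ (Re_gt0 e0).
exists (z, d z); split; first by [].
by apply: he; split; apply/ball_rnorm' => //; rewrite rdistC.
Qed.

End LinSpan.

(** * Hilbert modules *)

Section HilbertModule.
Variables (R : realType) (B : cStarAlgType R) (E : hilbertModType B).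
Implicit Types (x y z : E) (b : B).

Lemma innerDl x y z : inner (x + y) z = inner x z + inner y z.
Proof. by rewrite -inner_star innerDr starD !inner_star. Qed.

Lemma innerZl (l : R[i]) x y : inner (l *: x) y = Num.conj l *: inner x y.
Proof. by rewrite -inner_star innerZr starZ inner_star. Qed.

Lemma innerBl x y z : inner (x - y) z = inner x z - inner y z.
Proof. by rewrite innerDl -scaleN1r innerZl rmorphN1 scaleN1r. Qed.

Lemma innerBr x y z : inner x (y - z) = inner x y - inner x z.
Proof. by rewrite innerDr -scaleN1r innerZr scaleN1r. Qed.

Lemma innerZRl (t : R) x y : inner (t%:C *: x) y = t%:C *: inner x y.
Proof. by rewrite innerZl; congr (_ *: _); apply: CrealP; rewrite complex_real. Qed.

Lemma inner_ractl x y b : inner (x *> b) y = star b ** inner x y.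
Proof. by rewrite -inner_star inner_ract starM inner_star. Qed.

Lemma rnorm_inner x : rnorm (inner x x) = rnorm x ^+ 2.
Proof. by apply: complexI; rewrite rmorphXn /= -!rnormE norm_inner. Qed.

Lemma rnorm_ract x b : rnorm (x *> b) <= rnorm x * rnorm b.
Proof.
rewrite -ler_sqr ?nnegrE ?mulr_ge0 ?rnorm_ge0// -rnorm_inner inner_ract inner_ractl.
apply: le_trans (rnorm_cmul _ _) _; rewrite exprMn -rnorm_inner [rnorm b ^+ 2]expr2 mulrA.
rewrite ler_wpM2r ?rnorm_ge0// mulrC -[rnorm b]rnorm_star; exact: rnorm_cmul.
Qed.

(** [<x b, x b> = b^* <x, x> b = (k b)^* (k b)], so [k] can stand in for [x] in norms. *)
Lemma rnorm_ract_root x (k b : B) : inner x x = star k ** k ->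
  rnorm (k ** b) = rnorm (x *> b).
Proof.
move=> hk; apply/eqP; rewrite -(@eqrXn2 _ 2)// ?rnorm_ge0//; apply/eqP.
by rewrite -rnorm_inner inner_ract inner_ractl hk -rnorm_cstar starM !cmulA.
Qed.

(** Only boundedness is used later, so 4 replaces the sharp Cauchy-Schwarz constant 1. Polarization
    bounds [<a, c> + <c, a>], the vector ['i a] gives the difference, and at unit vectors
    [(|a| + |c|)^2] is 4. *)
Lemma rnorm_inner_le x y : rnorm (inner x y) <= 4 * rnorm x * rnorm y.
Proof.
have diag (a c : E) : rnorm (inner a c + inner c a) <= (rnorm a + rnorm c) ^+ 2.
  have h1 := rnormD a c; have h2 := rnormD a (- c); rewrite rnormN in h2.
  have e : (2 : R)%:C *: (inner a c + inner c a) =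
      inner (a + c) (a + c) - inner (a - c) (a - c).
    rewrite innerBl !innerBr innerDl !innerDr addr_polar.
    by rewrite rmorph_nat scaler_nat mulr2n.
  have := congr1 (@rnorm R B) e; rewrite rnormZR ger0_norm// => e'.
  have := rnormD (inner (a + c) (a + c)) (- inner (a - c) (a - c)).
  rewrite -e' rnormN !rnorm_inner.
  have := rnorm_ge0 (a + c); have := rnorm_ge0 (a - c).
  by nra.
have le1 (a c : E) : rnorm (inner a c) <= (rnorm a + rnorm c) ^+ 2.
  have h1 := diag a c; have h2 := diag ('i%C *: a) c.
  have ni : rnorm ('i%C : R[i]^o) = 1.
    by rewrite /rnorm normc_def /= expr0n expr1n add0r sqrtr1.
  rewrite rnormZ ni mul1r innerZl innerZr complexiE conjCi scaleNr addrC -scalerBr in h2.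
  rewrite rnormZ -complexiE ni mul1r rdistC in h2.
  have := rnormD (inner a c + inner c a) (inner a c - inner c a).
  rewrite addrACA subrr addr0 -[X in rnorm (X + _)]scale1r -[X in rnorm (_ + X)]scale1r.
  rewrite -scalerDl -(rmorph1 (real_complex R)) -rmorphD rnormZR ger0_norm; last by lra.
  by lra.
have inner0l (a c : E) : rnorm a = 0 -> rnorm (inner a c) = 0.
  by move=> /rnorm_eq0 ->; rewrite -(scale0r (0 : E)) innerZl rmorph0 scale0r rnorm0.
have [x0|x0] := eqVneq (rnorm x) 0; first by rewrite (inner0l _ _ x0) x0 mulr0 mul0r.
have [y0|y0] := eqVneq (rnorm y) 0.
  by rewrite -inner_star rnorm_star (inner0l _ _ y0) y0 mulr0.
have xp : 0 < rnorm x by rewrite lt_neqAle eq_sym x0 rnorm_ge0.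
have yp : 0 < rnorm y by rewrite lt_neqAle eq_sym y0 rnorm_ge0.
have := le1 ((rnorm x)^-1%:C *: x) ((rnorm y)^-1%:C *: y).
rewrite innerZRl innerZr !rnormZR !normfV !(ger0_norm (rnorm_ge0 _)) !mulVf//.
rewrite ler_pdivrMl// ler_pdivrMl//; lra.
Qed.

(** Expanding at [x + y] gives [T x y = - T y x]; the same with ['i x] for [x] removes the sign, and
    together they force zero. *)
Lemma polarization (T : E -> E -> B) :
  (forall x y z, T (x + y) z = T x z + T y z) ->
  (forall x y z, T x (y + z) = T x y + T x z) ->
  (forall (l : R[i]) x y, T (l *: x) y = Num.conj l *: T x y) ->
  (forall (l : R[i]) x y, T x (l *: y) = l *: T x y) ->
  (forall x, T x x = 0) -> forall x y, T x y = 0.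
Proof.
move=> TDl TDr TZl TZr T0 x y.
have sk a c : T a c = - T c a.
  have := T0 (a + c); rewrite TDl !TDr !T0 add0r addr0 => /eqP.
  by rewrite addr_eq0 => /eqP.
have := sk ('i%C *: x) y; rewrite TZl TZr complexiE conjCi scaleNr => /oppr_inj.
move=> /(scalerI (neq0Ci _)) h.
have := sk x y; rewrite -h => /eqP; rewrite -addr_eq0 -mulr2n -scaler_nat.
by rewrite scaler_eq0 pnatr_eq0 => /eqP.
Qed.

End HilbertModule.

(** * Compatibility of [u] and [phi], and the core *)

Section Main.
Variables (R : realType) (B : cStarAlgType R) (E : hilbertModType B).
Variables (d : linop B) (phi : R -> B -> B) (delta : linop E) (u : R -> E -> E).
Hypotheses (fullE : full E) (sd : is_star_derivation d).
Hypotheses (gphi : is_C0_group phi) (hd : is_generator d phi).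
Hypotheses (dd : is_derivation_over d delta).
Hypotheses (gu : is_C0_group u) (hdelta : is_generator delta u).

Lemma group_cmul t a b : phi t (a ** b) = phi t a ** phi t b.
Proof.
have [den dM _ Leib _] := sd.
apply: (@leibniz_intertwine _ _ _ _ _ 1 _ _ _ _ _ _ phi phi phi d d d) => //.
- exact: cmulDl.
- exact: cmulDr.
- by move=> s x y; apply: cmulZl.
- by move=> s x y; apply: cmulZr.
- by move=> x y; rewrite mul1r; apply: rnorm_cmul.
- by move=> x y dx dy; split; [apply: dM|apply: Leib].
Qed.

Lemma group_ract t x b : u t (x *> b) = u t x *> phi t b.
Proof.
have [den _ _ _ _] := sd; have [den' Leib] := dd.
apply: (@leibniz_intertwine _ _ _ _ _ 1 _ _ _ _ _ _ u phi u delta d delta) => //.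
- exact: ractDl.
- exact: ractDr.
- by move=> s y c; apply: ractZl.
- by move=> s y c; apply: ractZr.
- by move=> y c; rewrite mul1r; apply: rnorm_ract.
Qed.

(** [star] is a conjugate linear map of one variable, so [flow_intertwine] is applied directly; real
    difference quotients commute with [star]. *)
Lemma group_star t b : phi t (star b) = star (phi t b).
Proof.
have [den _ dS _ Sd] := sd.
have lip a c : rnorm (star a - star c : B) <= 1 * rnorm (a - c).
  by rewrite mul1r -starB rnorm_star.
move: b; apply: (dense_eq (K := 1) (L := 1) den) => [a c|a c|b db].
- by rewrite (rdist_group gphi).
- by apply: le_trans (lip _ _) _; rewrite (rdist_group gphi).
apply: (@flow_intertwine _ _ _ gphi _ phi (fun b => b \in dom d)) => //.
- exact: group0.
- exact: groupD.
- by move=> s a da; exact: (proj1 (generator_group gphi hd _ da)).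
- move=> a da; have h1 := generator_tends0 hd (dS _ da).
  have h2 : tends0 (fun s => (s^-1)%:C *: (star (phi s a) - star a)) (star (d a)).
    apply: (tends0_le (K := 1)) (generator_tends0 hd da) => // s _.
    rewrite mul1r -(rnorm_star (_ - d a)) [X in _ <= rnorm X]starB starZ starB.
    rewrite (_ : Num.conj (s^-1)%:C = (s^-1)%:C)//.
    by apply: CrealP; rewrite complex_real.
  have := tends0D h1 (tends0N h2); rewrite Sd// subrr.
  move=> h e /h[k k0 hk]; exists k => // s s0 sk; have := hk s s0 sk.
  by rewrite -scalerBr opprB subrKA.
Qed.

Lemma group_automorphism t : is_star_automorphism (phi t).
Proof.
split.
- by case: gphi.
- by exists (phi (- t)) => b; rewrite ?(groupNK gphi) ?(groupKN gphi).
- exact: group_cmul.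
- exact: group_star.
Qed.

Lemma group_inner_diag t x : inner (u t x) (u t x) = phi t (inner x x).
Proof.
have [k hk] := inner_pos x; have [l hl] := inner_pos (u t x).
suff e : star k ** k = star (phi (- t) l) ** phi (- t) l.
  by rewrite hl hk e group_cmul group_star (groupKN gphi).
(* Both norms equal [|x b|]; for the second, apply [phi t], then [group_ract] and the isometry of
   [u t]. *)
apply: cstar_norm_eq => b.
rewrite (rnorm_ract_root _ hk) -(rnorm_group gphi t (_ ** b)) group_cmul.
by rewrite (groupKN gphi) (rnorm_ract_root _ hl) -group_ract (rnorm_group gu).
Qed.

Lemma group_inner t x y : inner (u t x) (u t y) = phi t (inner x y).
Proof.
apply/eqP; rewrite -subr_eq0; apply/eqP.
apply: (@polarization _ _ _
  (fun x y => inner (u t x) (u t y) - phi t (inner x y))).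
- move=> a b c; rewrite (group_linD gu) !innerDl (group_linD gphi) opprD.
  by rewrite addrACA.
- move=> a b c; rewrite (group_linD gu) !innerDr (group_linD gphi) opprD.
  by rewrite addrACA.
- by move=> l a b; rewrite (group_linZ gu) !innerZl (group_linZ gphi) scalerBr.
- by move=> l a b; rewrite (group_linZ gu) !innerZr (group_linZ gphi) scalerBr.
- by move=> a; rewrite group_inner_diag subrr.
Qed.

Lemma inner_dom x y : x \in dom delta -> y \in dom delta ->
  inner x y \in dom d /\ d (inner x y) = inner (delta x) y + inner x (delta y).
Proof.
apply: (@intertwine_leibniz _ _ _ _ _ 4 _ _ _ _ _ _ u u phi) => //.
- exact: innerDl.
- exact: innerDr.
- exact: innerZRl.
- by move=> s a b; apply: innerZr.
- exact: rnorm_inner_le.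
- by move=> t a b; rewrite group_inner.
Qed.

Lemma inner_span_dense : dense (lin_span (inner_set (dom delta) (dom delta))).
Proof.
have [den _] := dd; set D := lin_span _.
apply: approx_dense => w e e0; have e2 : 0 < e / 2 by lra.
have [z zF zw] := dense_approx w fullE e2.
suff [y Dy zy] : exists2 y, y \in D & rnorm (z - y) < e / 2.
  by exists y => //; apply: le_lt_trans (rdistD z _ _) _; lra.
(* The tolerance is generalized, since the step for [a x + y] needs a smaller one, depending on
   [|a|], for [x]. *)
move: z zF {zw} (e / 2) e2; apply: lin_span_ind.
- by move=> f f0; exists 0; [exact: lin_span0|rewrite subrr rnorm0].
- move=> a x y hx hy f f0.
  have a1 : 0 < rnorm (a : R[i]^o) + 1 by have := rnorm_ge0 (a : R[i]^o); lra.
  have f2 : 0 < f / 2 by lra.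
  have [x' Dx hx'] := hx _ (divr_gt0 f2 a1); have [y' Dy hy'] := hy _ f2.
  exists (a *: x' + y'); first exact: lin_span_lin.
  rewrite opprD addrACA -scalerBr; apply: le_lt_trans (rnormD _ _) _; rewrite rnormZ.
  move: hx'; rewrite ltr_pdivlMr// => hx'.
  have := rnorm_ge0 (x - x'); have := rnorm_ge0 (a : R[i]^o).
  by nra.
move=> b; rewrite inE => -[x [y [_ _ ->]]] f f0.
have f2 : 0 < f / 2 by lra.
have c1 : 0 < 4 * rnorm y + 1 by have := rnorm_ge0 y; lra.
have [x' Dx hx] := dense_approx x den (divr_gt0 f2 c1).
(* [y'] is chosen after [x'], since its tolerance depends on [|x'|]. *)
have c2 : 0 < 4 * rnorm x' + 1 by have := rnorm_ge0 x'; lra.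
have [y' Dy hy] := dense_approx y den (divr_gt0 f2 c2).
exists (inner x' y').
  by apply: mem_lin_span; rewrite inE; exists x', y'.
apply: le_lt_trans (rdistD (inner x' y) _ _) _; rewrite -innerBl -innerBr.
have := rnorm_inner_le (x - x') y; have := rnorm_inner_le x' (y - y').
move: hx hy; rewrite !ltr_pdivlMr// => hx hy.
have := rnorm_ge0 (x - x'); have := rnorm_ge0 (y - y').
have := rnorm_ge0 x'; have := rnorm_ge0 y.
by nra.
Qed.

Lemma inner_span_core : is_core d (lin_span (inner_set (dom delta) (dom delta))).
Proof.
set D := lin_span _.
have subD : submod_closed [in D].
  by split=> [|a x y Dx Dy]; [exact: lin_span0|exact: lin_span_lin].
have Ddom : D `<=` dom d.
  move=> b Db; suff : b \in dom d by rewrite inE.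
  have : b \in D by rewrite inE.
  move: b {Db}; have [d0 dlin] := dom_submod d.
  apply: lin_span_ind => [//|a x y dx dy|b]; first exact: (dlin a x y).
  by rewrite inE => -[x [y [dx dy ->]]]; exact: (proj1 (inner_dom dx dy)).
have Dinv t y : y \in D -> phi t y \in D.
  apply: (lin_span_ind (P := fun y => phi t y \in D)) => [|a x z hx hz|b].
  - by rewrite (group_lin0 gphi) lin_span0.
  - by rewrite (group_linD gphi) (group_linZ gphi) lin_span_lin.
  - rewrite inE => -[x [z [dx dz ->]]]; apply: mem_lin_span.
    rewrite inE -group_inner; exists (u t x), (u t z); split => //.
      exact: (proj1 (generator_group gu hdelta _ dx)).
    exact: (proj1 (generator_group gu hdelta _ dz)).
split=> //; apply/seteqP; split=> -[x y].
- move=> /closure_graph h.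
  have [dx <-] : x \in dom d /\ d x = y; last by split.
  apply: (generator_closed gphi hd) => e /h[z [Dz z1 z2]]; exists z; split=> //.
  by move: Dz; rewrite !inE; exact: Ddom.
- move=> [/= dx ->]; apply/closure_graph => e e0.
  exact: (generator_core gphi hd inner_span_dense).
Qed.

End Main.

Theorem theorem3p18 (R : realType) (B : cStarAlgType R) (E : hilbertModType B)
    (d : linop B) (phi : R -> B -> B) (delta : linop E) (u : R -> E -> E) :
  full E ->
  is_star_derivation d -> is_C0_group phi -> is_generator d phi ->
  is_derivation_over d delta -> is_C0_group u -> is_generator delta u ->
  [/\ is_dynamical_system u, is_associated_system u phi,
      is_core d (lin_span (inner_set (dom delta) (dom delta))),
      is_ternary_derivation delta
    & is_derivation_over d delta].
Proof.
move=> fullE sd gphi hd dd gu hdelta.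
have aut := group_automorphism sd gphi hd.
have inn := group_inner sd gphi hd dd gu hdelta.
split=> //.
- split; [by case: gu|by case: gu|move=> t; split].
    by move=> y; exists (u (- t) y); rewrite (groupKN gu).
  by exists (phi t).
- split; last by [].
  by split; [case: gphi|case: gphi|].
- exact: (inner_span_core fullE sd gphi hd dd gu hdelta).
(* The ternary rule is the rule for a [d]-derivation at [b = <y, z>], which lies in [dom d] by
   [inner_dom]. *)
- have [den Leib] := dd; split=> // x y z dx dy dz.
  have [dyz eyz] := inner_dom sd gphi hd dd gu hdelta dy dz.
  have [dxyz ->] := Leib _ _ dx dyz.
  by split=> //; rewrite eyz ractDr addrA.
Qed.
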